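(* Let $P\subset\mathbb{R}^2$ be a convex polygon which is not a parallelogram. Then every multiple tiling of $P$ is periodic: if $\Lambda$ is a discrete multi-set in $\mathbb{R}^2$ such that $P+\Lambda$ multi-tiles, then there exists a lattice $L\subset\mathbb{R}^2$ such that $\Lambda+L=\Lambda$ (equivalently, $\Lambda$ is a finite union, counted with multiplicity, of translates of the single lattice $L$).
   Context: A lattice of $\mathbb{R}^2$ is a discrete subgroup of $\mathbb{R}^2$ isomorphic to $\mathbb{Z}^2$ (full rank). A discrete multi-set $\Lambda$ in $\mathbb{R}^2$ is a discrete set each of whose points has a finite multiplicity in $\{1,2,\dots\}$. $P+\Lambda$ multi-tiles if there is a positive integer $k$ with $\sum_{\lambda\in\Lambda}\chi_P(x-\lambda)=k$ for almost every $x\in\mathbb{R}^2$ (sum counted with multiplicity), where $\chi_P$ is the indicator function of $P$. For a multi-set $\Lambda$, $\Lambda+L=\Lambda$ means that $\Lambda$ is invariant, with multiplicities, under translation by every element of $L$. Polygons have non-empty interior. *)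

(* Defs.v *)
From HB Require Import structures.
From mathcomp Require Import all_boot all_order all_algebra.
From mathcomp Require Import all_classical all_reals all_analysis.

Set Implicit Arguments.
Unset Strict Implicit.
Unset Printing Implicit Defensive.

Import Order.TTheory GRing.Theory Num.Theory.
Import numFieldNormedType.Exports.

Local Open Scope classical_set_scope.
Local Open Scope ring_scope.

Definition convex_hull (R : realType) (A : set (R * R)) : set (R * R) :=
  smallest (@convex_set R (R * R)%type) A.

(* The points of [s] need not be vertices, and [P] is closed. *)
Definition convex_polygon (R : realType) (P : set (R * R)) : Prop :=
  (exists s : seq (R * R), P = convex_hull [set` s]) /\ P° !=set0.

Definition parallelogram (R : realType) (P : set (R * R)) : Prop :=
  exists a u v : R * R, u.1 * v.2 != u.2 * v.1 /\
    P = [set a + s *: u + t *: v | s in `[0, 1] & t in `[0, 1]].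

Definition discrete_subset (R : realType) (A : set (R * R)) : Prop :=
  A `<=` isolated A.

(* A multi-set is given by its multiplicity function; the points of
   multiplicity 0 are those which do not belong to it. *)
Definition mset_support (R : realType) (Lambda : R * R -> nat) : set (R * R) :=
  [set l | (0 < Lambda l)%N].

Definition discrete_multiset (R : realType) (Lambda : R * R -> nat) : Prop :=
  discrete_subset (mset_support Lambda).

Definition multi_tiles (R : realType) (P : set (R * R))
    (Lambda : R * R -> nat) : Prop :=
  exists k : nat, (0 < k)%N /\
    {ae ((@lebesgue_measure R) \x (@lebesgue_measure R))%E, forall x : R * R,
      \esum_(l in mset_support Lambda)
        ((Lambda l)%:R * \1_P (x - l) : R)%:E = (k%:R : R)%:E}.

Definition lattice (R : realType) (L : set (R * R)) : Prop :=
  [/\ zmod_closed [in L],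
      discrete_subset L &
      exists f : {additive (int * int)%type -> (R * R)%type},
        injective f /\ range f = L].

Definition translation_invariant (R : realType) (Lambda : R * R -> nat)
    (L : set (R * R)) : Prop :=
  forall l x, L l -> Lambda (x + l) = Lambda x.

(* [Lambda] is the union, with multiplicities, of the translates [t + L]
   for [t] in the list [s] (repetitions allowed). *)
Definition finite_union_of_translates (R : realType) (Lambda : R * R -> nat)
    (L : set (R * R)) : Prop :=
  exists s : seq (R * R), forall x, Lambda x = count (fun t => x - t \in L) s.

(* Main.v *)
Require Import Defs.
From HB Require Import structures.
From mathcomp Require Import all_boot all_order all_algebra.
From mathcomp Require Import all_classical all_reals all_analysis.
From mathcomp Require Import finmap ring lra zify.
Import Order.TTheory GRing.Theory Num.Theory.
Import numFieldNormedType.Exports.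
Local Open Scope classical_set_scope.
Local Open Scope ring_scope.

(* Write T_w for the translation by w. Crossing an edge of direction e of the translates of P shows that the
   mass of Lambda on half-open segments [y, y - e) is invariant under the translation tau that maps this edge
   to the opposite one. A length comparison shows that opposite edges are equal, so P is centrally symmetric,
   and (1 - T_e) (1 - T_tau) Lambda = 0. However e or tau is chosen in each of the (at least three) pairs,
   the chosen vectors span the plane, and a bounded function killed by (1 - T_w)^2 is killed by 1 - T_w; so
   Lambda is periodic if all e and tau lie in one two-dimensional rational space. Otherwise
   (1 - T_tau) (1 - T_tau') Lambda = 0 for any two pairs (e, tau) and (e', tau'): were this function non-zero,
   it would be periodic under e and e' with finite support modulo these, so that Q e + Q e' contains e'' or
   tau'' for every pair, while counting disjoint segments forces multiples of tau into R e + Z e' and of tau'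
   into R e' + Z e, and together these put all vectors into Q e + Q e'. The parity of the number of pairs and
   the same choice argument then give two independent periods. *)

Set Implicit Arguments.
Unset Strict Implicit.
Unset Printing Implicit Defensive.

(** * Plane vectors, finite differences and rational periods *)

Section Plane.
Context {R : realType}.
Implicit Types (u v w x y a b : R * R) (F G : R * R -> int).

(** Three pairs of edges matter because of the way two choices can fail: the [e] are pairwise
    independent and so are the [tau], but an [e] of one pair may be parallel to the [tau] of
    another, as in a parallelogram, where each [tau] is up to sign the edge of the other pair. Among
    three choices two are of the same kind. The equation (1 - T_e) (1 - T_tau) Lambda = 0 gives
    periods to differences of Lambda, not to Lambda itself; boundedness carries them back at the
    cost of passing to multiples, which is why periods are taken up to a positive integer factor and
    the linear algebra is rational. In the irrational case everything is expressed by the diagonals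
    V k joining opposite vertices: 2 e = V k - V (k+1) and 2 tau = V k + V (k+1), so that one vector
    of each pair, known modulo a rational plane, determines all V k up to sign from V 0, and V m = -
    V 0 brings in the parity. Measure enters only through the fact that an almost everywhere
    property holds at some point of every box. *)

Lemma pairP u v : u.1 = v.1 -> u.2 = v.2 -> u = v.
Proof. by case: u v => [? ?] [? ?] /= -> ->. Qed.

Lemma fstZ (t : R) u : (t *: u).1 = t * u.1. Proof. by []. Qed.
Lemma sndZ (t : R) u : (t *: u).2 = t * u.2. Proof. by []. Qed.
Lemma fstD u v : (u + v).1 = u.1 + v.1. Proof. by []. Qed.
Lemma sndD u v : (u + v).2 = u.2 + v.2. Proof. by []. Qed.
Lemma fstN u : (- u).1 = - u.1. Proof. by []. Qed.
Lemma sndN u : (- u).2 = - u.2. Proof. by []. Qed.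
Lemma fst0 : (0 : R * R).1 = 0. Proof. by []. Qed.
Lemma snd0 : (0 : R * R).2 = 0. Proof. by []. Qed.

Definition coordE :=
  (fstZ, sndZ, fstD, sndD, fstN, sndN, fst0, snd0).

Definition cross u v : R := u.1 * v.2 - u.2 * v.1.

End Plane.

Ltac vring := apply: pairP; rewrite ?coordE; ring.

Section Periods.
Context {R : realType}.
Implicit Types (u v w x y a b : R * R) (F G : R * R -> int).

Lemma cross_basis a b x : cross a b != 0 ->
  x = (cross x b / cross a b) *: a + (cross a x / cross a b) *: b.
Proof. by rewrite /cross => ab; apply: pairP; rewrite !coordE; field. Qed.

Lemma cross_neq0l a b : cross a b != 0 -> a != 0.
Proof. by apply: contra_neq => ->; rewrite /cross !coordE; ring. Qed.

Definition fdiff w F : R * R -> int := fun x => F x - F (x - w).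

Definition bnd_fun F := exists K : int, forall x, `|F x| <= K.

(** A period up to a positive integer factor, so that these vectors form a rational vector space
    ([perD], [perN], [perZ]). *)
Definition per F w :=
  exists2 N, (0 < N)%N & forall x, F (x + N%:R *: w) = F x.

Lemma bnd_fdiff w F : bnd_fun F -> bnd_fun (fdiff w F).
Proof.
move=> [K FK]; exists (K + K) => x; rewrite /fdiff.
by rewrite (le_trans (ler_normB _ _))// lerD.
Qed.

Lemma fdiffC a b F : fdiff a (fdiff b F) = fdiff b (fdiff a F).
Proof.
apply/funext => x; rewrite /fdiff (_ : x - a - b = x - b - a); first by ring.
by vring.
Qed.

Lemma fdiff_eq0P w F : fdiff w F = (fun=> 0) <-> forall x, F (x + w) = F x.
Proof.
split => [H x|H].
  move/(congr1 (@^~ (x + w))): H; rewrite /fdiff /= addrK.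
  by move=> /eqP; rewrite subr_eq0 => /eqP.
by apply/funext => x; rewrite /fdiff -(H (x - w)) subrK subrr.
Qed.

Lemma periodM F w : (forall x, F (x + w) = F x) ->
  forall (n : nat) x, F (x + n%:R *: w) = F x.
Proof.
move=> H; elim => [|n IH] x; first by rewrite scale0r addr0.
by rewrite -(IH x) -[RHS]H; congr F; rewrite -natr1; vring.
Qed.

Lemma perD F a b : per F a -> per F b -> per F (a + b).
Proof.
move=> [N N0 HN] [M M0 HM]; exists (N * M)%N; first by rewrite muln_gt0 N0.
move=> x; rewrite -(periodM HN M x) -[RHS](periodM HM N); congr F.
by rewrite natrM; vring.
Qed.

Lemma perN F a : per F a -> per F (- a).
Proof.
move=> [N N0 HN]; exists N => // x; rewrite -[LHS]HN; congr F; vring.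
Qed.

Lemma perZ F a (t : rat) : per F a -> per F (ratr t *: a).
Proof.
move=> [N N0 HN].
wlog t0 : t / 0 <= t => [H|].
  have [/H//|t0] := leP 0 t.
  have : per F (ratr (- t) *: a) by apply: H; rewrite oppr_ge0 ltW.
  by move=> /perN; rewrite rmorphN scaleNr opprK.
exists (N * `|denq t|)%N; first by rewrite muln_gt0 N0 absz_gt0 denq_neq0.
move=> x; rewrite -(periodM HN `|numq t| x); congr F; congr (x + _).
rewrite !scalerA natrM -mulrA; congr (_ *: _); rewrite [RHS]mulrC; congr (_ * _).
rewrite !natr_absz ger0_norm ?denq_ge0// ger0_norm ?numq_ge0//.
rewrite -(ratr_int R (denq t)) -(ratr_int R (numq t)) -rmorphM/=; congr ratr.
by rewrite mulrC -numqE.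
Qed.

Definition spanQ a b x := exists s t : rat, x = ratr s *: a + ratr t *: b.

Lemma spanQ_per F a b x : per F a -> per F b -> spanQ a b x -> per F x.
Proof. by move=> Fa Fb [s [t ->]]; apply: perD; exact: perZ. Qed.

Lemma spanQl a b : spanQ a b a.
Proof. by exists 1, 0; rewrite rmorph1 rmorph0 scale1r scale0r addr0. Qed.
Lemma spanQr a b : spanQ a b b.
Proof. by exists 0, 1; rewrite rmorph1 rmorph0 scale1r scale0r add0r. Qed.

Lemma spanQD a b x y : spanQ a b x -> spanQ a b y -> spanQ a b (x + y).
Proof.
move=> [s [t ->]] [s' [t' ->]]; exists (s + s'), (t + t').
by rewrite !rmorphD /=; vring.
Qed.

Lemma spanQZ a b x (r : rat) : spanQ a b x -> spanQ a b (ratr r *: x).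
Proof.
move=> [s [t ->]]; exists (r * s), (r * t); rewrite !rmorphM /=; vring.
Qed.

Lemma spanQN a b x : spanQ a b x -> spanQ a b (- x).
Proof. by move=> /(spanQZ (-1)); rewrite rmorphN rmorph1 scaleN1r. Qed.

Lemma spanQB a b x y : spanQ a b x -> spanQ a b y -> spanQ a b (x - y).
Proof. by move=> ax /spanQN; exact: spanQD. Qed.

Lemma spanQ_half a b x : spanQ a b (2 *: x) -> spanQ a b x.
Proof.
move=> /(spanQZ 2^-1); rewrite scalerA fmorphV rmorph_nat mulVf ?scale1r//.
Qed.

(* Both sides are two-dimensional over the rationals. *)
Lemma spanQ_basis a b w w' x : cross w w' != 0 ->
  spanQ a b w -> spanQ a b w' -> spanQ a b x -> spanQ w w' x.
Proof.
move=> ww' [s [t ew]] [s' [t' ew']].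
have e : cross w w' = ratr (s * t' - t * s') * cross a b.
  by rewrite ew ew' rmorphB !rmorphM /cross !coordE; ring.
have d0 : s * t' - t * s' != 0.
  by apply: contra_neq ww' => d0; rewrite e d0 rmorph0 mul0r.
have r0 : ratr (s * t' - t * s') != 0 :> R by rewrite fmorph_eq0.
move=> [p [q ->]].
exists ((p * t' - q * s') / (s * t' - t * s')), ((q * s - p * t) / (s * t' - t * s')).
rewrite ew ew' !fmorph_div /=; move: r0; rewrite !rmorphB !rmorphM /= => r0.
by apply: pairP; rewrite !coordE; field.
Qed.

End Periods.

Section BoundedFunctions.
Context {R : realType}.
Implicit Types (u v w x y z a b c : R * R) (F G : R * R -> int).

(** On each progression x + n w the function is affine in n, and a non-zero integral slope is
    incompatible with boundedness. *)
Lemma fdiff_fdiff_eq0 w F : bnd_fun F ->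
  fdiff w (fdiff w F) = (fun=> 0) -> fdiff w F = (fun=> 0).
Proof.
move=> [K FK] /fdiff_eq0P H; apply/funext => x.
have E n : F (x + n%:R *: w) = F x + n%:Z * fdiff w F x.
  elim: n => [|n IH]; first by rewrite scale0r addr0 mul0r addr0.
  have := periodM H n.+1 x; rewrite /fdiff.
  rewrite (_ : x + n.+1%:R *: w - w = x + n%:R *: w); last first.
    by rewrite -natr1; vring.
  by rewrite IH /fdiff -natr1 => e; rewrite -[LHS](subrK (F x + n%:Z * (F x - F (x - w)))) e; ring.
apply/eqP; apply: contraT => d0.
(* After n steps a slope of absolute value at least 1 moves the value by at least n, more than the
   largest possible oscillation K + K. *)
pose n := (absz (K + K)).+1.
have := E n => /(congr1 (fun t => t - F x)); rewrite addrAC subrr add0r => e.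
have : `|n%:Z * fdiff w F x| <= K + K.
  by rewrite -e (le_trans (ler_normB _ _))// lerD.
have d1 : 1 <= `|fdiff w F x| by rewrite -gtz0_ge1 normr_gt0.
rewrite normrM (ger0_norm (_ : 0 <= n%:Z))// => h.
have : n%:Z <= K + K by rewrite (le_trans _ h)// ler_peMr.
by rewrite /n; lia.
Qed.

Lemma fdiff_mulrn w F n : fdiff w F = (fun=> 0) -> fdiff (n%:R *: w) F = (fun=> 0).
Proof. by move=> /fdiff_eq0P H; apply/fdiff_eq0P => x; exact: periodM. Qed.

(** Since 1 - T_a kills (1 - T_b) F, some N x is a period of the latter; then 1 - T_b kills (1 -
    T_{N x}) F, which so has a period M x. Hence (1 - T_{M N x})^2 kills F, and boundedness removes
    the square. The class [C] is closed under differences so that both hypotheses apply to these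
    auxiliary functions. *)
Lemma per_split (C : (R * R -> int) -> Prop) a b x :
  (forall F w, C F -> C (fdiff w F)) -> (forall F, C F -> bnd_fun F) ->
  (forall F, C F -> fdiff a F = (fun=> 0) -> per F x) ->
  (forall F, C F -> fdiff b F = (fun=> 0) -> per F x) ->
  forall F, C F -> fdiff a (fdiff b F) = (fun=> 0) -> per F x.
Proof.
move=> Cd Cb Ha Hb F CF ab0.
have [N N0 /fdiff_eq0P HN] := Ha _ (Cd _ b CF) ab0.
have bw0 : fdiff b (fdiff (N%:R *: x) F) = (fun=> 0) by rewrite fdiffC.
have [M M0 /fdiff_eq0P HM] := Hb _ (Cd _ _ CF) bw0.
exists (M * N)%N; first by rewrite muln_gt0 M0.
apply/fdiff_eq0P; apply: fdiff_fdiff_eq0; first exact: Cb.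
rewrite {1}(_ : (M * N)%:R *: x = M%:R *: (N%:R *: x)); last first.
  by rewrite scalerA natrM.
apply: fdiff_mulrn; rewrite fdiffC.
rewrite (_ : (M * N)%:R *: x = N%:R *: (M%:R *: x)); last first.
  by rewrite scalerA -natrM mulnC.
by apply: fdiff_mulrn.
Qed.

Definition locfin F := forall r : R, exists K, forall l, uniq l ->
  (forall x, x \in l -> [/\ `|x.1| <= r, `|x.2| <= r & F x != 0]) ->
  (size l <= K)%N.

Lemma locfin_fdiff w F : locfin F -> locfin (fdiff w F).
Proof.
move=> H r; have [K HK] := H r.
have [K' HK'] := H (r + `|w.1| + `|w.2|).
exists (K + K')%N => l ul Hl.
rewrite -(count_predC (fun x => F x != 0) l) leq_add//.
  rewrite -size_filter HK ?filter_uniq// => x; rewrite mem_filter => /andP[Fx xl].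
  by have [? ? _] := Hl _ xl.
rewrite -size_filter -(size_map (fun x => x - w)) HK'//.
  by rewrite map_inj_uniq ?filter_uniq// => u v /addIr.
move=> _ /mapP[x + ->]; rewrite mem_filter /= => /andP[/negPn/eqP Fx0 xl].
have [x1 x2] := Hl _ xl; rewrite /fdiff Fx0 sub0r oppr_eq0 => ?; split => //.
  by rewrite (le_trans (ler_normB _ _))//; have := normr_ge0 w.2; lra.
by rewrite (le_trans (ler_normB _ _))//; have := normr_ge0 w.1; lra.
Qed.

Lemma periodMz F w : (forall x, F (x + w) = F x) ->
  forall (n : int) x, F (x + n%:~R *: w) = F x.
Proof.
move=> H [n|n] x; first exact: (periodM H).
by rewrite -[LHS](periodM H n.+1) NegzE; congr F; rewrite mulrNz; vring.
Qed.

(** Reducing the points z + n C modulo the periods A and B brings them into a bounded region without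
    changing the non-zero value of F. Only finitely many points are available there, so two of them
    coincide, which puts a non-zero multiple of C in Z A + Z B. *)
Lemma locfin_period a b c z F : locfin F -> F z != 0 -> cross a b != 0 ->
  per F a -> per F b -> per F c -> spanQ a b c.
Proof.
move=> Ff Fz ab [Na Na0 Ha] [Nb Nb0 Hb] [Nc Nc0 Hc].
set A := Na%:R *: a in Ha; set B := Nb%:R *: b in Hb; set C := Nc%:R *: c in Hc.
have AB : cross A B != 0.
  rewrite (_ : cross A B = Na%:R * Nb%:R * cross a b); last first.
    by rewrite /cross !coordE; ring.
  by rewrite !mulf_neq0// pnatr_eq0 -lt0n.
pose al (n : nat) := cross (n%:R *: C) B / cross A B.
pose be (n : nat) := cross A (n%:R *: C) / cross A B.
have CE n : n%:R *: C = al n *: A + be n *: B by exact: cross_basis.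
pose zn n := z + n%:R *: C + (- Num.floor (al n))%:~R *: A + (- Num.floor (be n))%:~R *: B.
have Fzn n : F (zn n) = F z.
  by rewrite /zn (periodMz Hb) (periodMz Ha) (periodM Hc).
have znE n : zn n = z + (al n - (Num.floor (al n))%:~R) *: A + (be n - (Num.floor (be n))%:~R) *: B.
  by rewrite /zn CE !mulrNz; vring.
pose r := `|z.1| + `|z.2| + (`|A.1| + `|A.2|) + (`|B.1| + `|B.2|).
have bnd (s p q : R) : `|p + (s - (Num.floor s)%:~R) * q| <= `|p| + `|q|.
  rewrite (le_trans (ler_normD _ _))// lerD2l normrM ler_piMl//.
  by have := floor_itv s; rewrite intrD1 ler_norml; lra.
have [K HK] := Ff r.
apply: contrapT => nspan.
have Rn n : n%:R = ratr n%:R :> R by rewrite rmorph_nat.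
have inj : injective zn.
  move=> i j; apply: contra_eq => ij; apply/eqP => e; apply: nspan.
  have d0 : (i%:R - j%:R : rat) != 0 by rewrite subr_eq0 eqr_nat.
  have e2 : ratr (i%:R - j%:R) *: C =
     ratr (Num.floor (al i) - Num.floor (al j))%:~R *: A +
     ratr (Num.floor (be i) - Num.floor (be j))%:~R *: B :> R * R.
    move: e; rewrite /zn rmorphB !rmorph_nat !ratr_int => e.
    rewrite scalerBl -[i%:R *: C](_ : zn i - z + (Num.floor (al i))%:~R *:
        A + (Num.floor (be i))%:~R *: B = _); last first.
      by rewrite /zn !mulrNz; vring.
    rewrite -[X in _ - X](_ : zn j - z + (Num.floor (al j))%:~R *: A + (Num.floor (be j))%:~R *:
        B = _); last first.
      by rewrite /zn !mulrNz; vring.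
    by rewrite /zn e !intrB; vring.
  have : spanQ a b (ratr (i%:R - j%:R) *: C).
    rewrite e2; apply: spanQD; apply: spanQZ.
      by rewrite /A Rn; apply: spanQZ; exact: spanQl.
    by rewrite /B Rn; apply: spanQZ; exact: spanQr.
  move=> /(spanQZ ((i%:R - j%:R)^-1 * Nc%:R^-1)).
  have r0 : i%:R - j%:R != 0 :> R by rewrite subr_eq0 eqr_nat.
  have r1 : Nc%:R != 0 :> R by rewrite pnatr_eq0 -lt0n.
  rewrite (_ : _ *: _ = c)//; rewrite /C !scalerA rmorphM !fmorphV rmorphB !rmorph_nat.
  by apply: pairP; rewrite !coordE; field; rewrite r0 r1.
have := HK (map zn (iota 0 K.+1)).
rewrite map_inj_uniq ?iota_uniq// size_map size_iota ltnn =>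
    /(_ isT) h; suff: false by []; apply: h.
move=> _ /mapP[n _ ->]; rewrite Fzn; split => //.
  rewrite znE !coordE (le_trans (bnd _ _ _))// (le_trans (lerD (bnd _ _ _) (lexx _)))//.
  by rewrite /r; have := normr_ge0 z.2; have := normr_ge0 A.2; have := normr_ge0 B.2; lra.
rewrite znE !coordE (le_trans (bnd _ _ _))// (le_trans (lerD (bnd _ _ _) (lexx _)))//.
by rewrite /r; have := normr_ge0 z.1; have := normr_ge0 A.1; have := normr_ge0 B.1; lra.
Qed.

End BoundedFunctions.

(** * The mass of a uniformly locally finite multi-set *)

Section Mass.
Context {R : realType}.
Implicit Types (u v w x y z a b c d : R * R) (A B : set (R * R)) (l : seq (R * R)).

Definition box a (r : R) : pred (R * R) :=
  fun x => (`|x.1 - a.1| <= r) && (`|x.2 - a.2| <= r).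

(* Quadratic growth of the mass of boxes; dyadic radii suffice. *)
Definition box_bound (L : R * R -> nat) (r : R) (K : nat) := forall t a l,
  uniq l -> all (box a (r * 2 ^+ t)) l -> (\sum_(x <- l) L x <= 4 ^ t * K)%N.

(** Doubling the radius cuts a square into four squares of the old radius; each point is charged to
    one of them by comparing its coordinates with the centre. *)
Lemma box_bound0 (L : R * R -> nat) r K : 0 < r ->
  (forall a l, uniq l -> all (box a r) l -> (\sum_(x <- l) L x <= K)%N) ->
  box_bound L r K.
Proof.
move=> r0 H; elim => [|t IH] a l ul al; first by rewrite expn0 mul1n (H a)// -[r]mulr1.
set s := r * 2 ^+ t in IH; have es : r * 2 ^+ t.+1 = s + s by rewrite /s exprS; ring.
rewrite {}es in al.
pose P1 x := a.1 <= x.1; pose P2 x := a.2 <= x.2.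
have Q (p q : bool) : (\sum_(x <- l | (P1 x == p) && (P2 x == q)) L x <= 4 ^ t * K)%N.
  rewrite -big_filter.
  apply: (IH (if p then a.1 + s else a.1 - s, if q then a.2 + s else a.2 - s)).
    exact: filter_uniq.
  apply/allP => x; rewrite mem_filter /P1 /P2 => /andP[/andP[/eqP <- /eqP <-]].
  move=> /(allP al); rewrite /box /= !ler_norml; clear.
  by case: (lerP a.1 x.1); case: (lerP a.2 x.2); lra.
rewrite (bigID (fun x => P1 x == true)) /= (bigID (fun x => P2 x == true)) /=.
rewrite addnC (bigID (fun x => P2 x == true)) /= expnS.
rewrite (_ : 4 * 4 ^ t * K = 4 ^ t * K + 4 ^ t * K + (4 ^ t * K + 4 ^ t * K))%N; last by ring.
have f (p : R * R -> bool) : (exists c c' : bool, forall x, p x = (P1 x == c) && (P2 x == c')) ->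
    (\sum_(x <- l | p x) L x <= 4 ^ t * K)%N.
  by move=> [c [c' pq]]; rewrite (eq_bigl _ _ pq).
rewrite !leq_add//; apply: f.
- by exists false, true => x; case: (P1 x); case: (P2 x).
- by exists false, false => x; case: (P1 x); case: (P2 x).
- by exists true, false => x; case: (P1 x); case: (P2 x).
Qed.

Definition bdd A := exists r, forall x, A x -> box 0 r x.

Lemma bddU A B : bdd A -> bdd B -> bdd (A `|` B).
Proof.
move=> [r H] [s H']; exists (Num.max r s) => x [/H|/H'];
by rewrite /box !le_max => /andP[-> ->]; rewrite ?orbT.
Qed.

Lemma bdd_box a r : bdd [set` box a r].
Proof.
exists (r + `|a.1| + `|a.2|) => x; rewrite /= /box !coordE !subr0 => /andP[h1 h2].
have := ler_distD a.1 x.1 0; have := ler_distD a.2 x.2 0; rewrite !subr0 => h3 h4.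
have := normr_ge0 a.1; have := normr_ge0 a.2.
by move=> *; apply/andP; split; lra.
Qed.

Variables (L : R * R -> nat) (r0 : R) (K0 : nat).
Hypotheses (r0_gt0 : 0 < r0) (Lb : box_bound L r0 K0).

(** The finitely supported sum takes its default value 0 on an infinite support, whence the
    boundedness hypotheses in the rules for [mass]. *)
Definition mass A : nat := \big[addn/0%N]_(x \in A) L x.

Lemma massE A l : uniq l -> (forall x, A x -> L x != 0%N -> x \in l) ->
  mass A = (\sum_(x <- l) L x * (x \in A))%N.
Proof.
move=> ul Al; rewrite /mass fsbig_mkcond -(fsbig_widen [set` l] setT)//.
  by rewrite -fsbig_seq//; apply: eq_bigr => x _; rewrite patchE; case: ifP; rewrite ?muln1 ?muln0.
move=> x [_ /= xl]; rewrite patchE; case: ifP => // /set_mem Ax.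
by apply: contrapT => /eqP /(Al _ Ax).
Qed.

Lemma pow2_ge (r : R) : exists t, r <= r0 * 2 ^+ t.
Proof.
exists (Num.truncn (r / r0)).+1; rewrite -ler_pdivrMl// mulrC.
have [h|h] := leP 0 (r / r0); last first.
  by rewrite (le_trans (ltW h))// exprn_ge0.
rewrite -natrX (le_trans (ltW (truncnS_gt _)))// ler_nat ltnW// ltn_expl//.
Qed.

Lemma cover_list A : bdd A ->
  exists l, uniq l /\ forall x, A x -> L x != 0%N -> x \in l.
Proof.
move=> [r Ar]; have [t rt] := pow2_ge r.
have fin : finite_set [set x | A x /\ L x != 0%N].
  apply: contrapT => /(infinite_set_fset (4 ^ t * K0).+1)[B BA cB].
  suff : (size B <= 4 ^ t * K0)%N by move/(leq_trans cB); rewrite ltnn.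
  rewrite (leq_trans _ (Lb (a := 0) (t := t) (finmap.fset_uniq B) _))//.
    rewrite -sum1_size !big_seq leq_sum// => x xB; have [_ Lx] := BA _ xB.
    by rewrite lt0n.
  apply/allP => x xB; have [/Ar + _] := BA _ xB.
  by rewrite /box => /andP[h1 h2]; rewrite !(le_trans _ rt).
move/finite_fsetP : fin => [X E]; exists X; split; first exact: finmap.fset_uniq.
by move=> x Ax Lx; have : [set` X] x by rewrite -E.
Qed.

Lemma cover_list2 A B : bdd A -> bdd B -> exists l, [/\ uniq l,
  forall x, A x -> L x != 0%N -> x \in l & forall x, B x -> L x != 0%N -> x \in l].
Proof.
move=> bA bB; have [l [ul lP]] := cover_list (bddU bA bB).
by exists l; split => // x H; apply: lP; [left|right].
Qed.

Lemma mass_sub A B : bdd B -> A `<=` B -> (mass A <= mass B)%N.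
Proof.
move=> bB AB; have [l [ul lB]] := cover_list bB.
rewrite (massE ul lB) (massE ul (fun x Ax => lB x (AB x Ax))).
apply: leq_sum => x _; rewrite leq_mul2l; apply/orP; right.
by have [/set_mem/AB/mem_set ->|] := boolP (x \in A).
Qed.

Lemma massU A B : bdd A -> bdd B -> A `&` B = set0 ->
  mass (A `|` B) = (mass A + mass B)%N.
Proof.
move=> bA bB AB; have [l [ul lA lB]] := cover_list2 bA bB.
rewrite (massE ul lA) (massE ul lB) (@massE _ l)//; last first.
  by move=> x [/lA|/lB].
rewrite -big_split /=; apply: eq_bigr => x _; rewrite -mulnDr; congr muln.
rewrite in_setU; have [xA|] := boolP (x \in A); have [xB|] := boolP (x \in B) => //.
by have := conj (set_mem xA) (set_mem xB); rewrite -[_ /\ _]/((A `&` B) x) AB.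
Qed.

Lemma mass_set0 : mass set0 = 0%N.
Proof. by rewrite /mass fsbig_set0. Qed.

Lemma mass_set1 x : mass [set x] = L x.
Proof. by rewrite /mass fsbig_set1. Qed.

Lemma mass_pos A x : bdd A -> A x -> (L x <= mass A)%N.
Proof. by move=> bA Ax; rewrite -mass_set1 mass_sub// => y ->. Qed.

Lemma mass_disjoint (I : finType) (F : I -> set (R * R)) B : bdd B ->
  (forall i, F i `<=` B) -> (forall i j, F i `&` F j !=set0 -> i = j) ->
  (\sum_i mass (F i) <= mass B)%N.
Proof.
move=> bB FB FI; have [l [ul lB]] := cover_list bB.
under eq_bigr => i _ do rewrite (massE ul (fun x Fx => lB x (FB i x Fx))).
rewrite exchange_big (massE ul lB) /=; apply: leq_sum => x _.
rewrite -big_distrr /= leq_mul2l; apply/orP; right.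
have [[i xi]|nx] := pselect (exists i, x \in F i); last first.
  rewrite big1// => i _; apply/eqP; rewrite eqb0; apply/negP => xi.
  by apply: nx; exists i.
rewrite (bigD1 i)//= xi big1 ?addn0 => [|j ji].
  by rewrite (mem_set (FB i x (set_mem xi))).
apply/eqP; rewrite eqb0; apply: contra ji => xj; apply/eqP/FI.
by exists x; split; exact: set_mem.
Qed.

Lemma mass_box t a : (mass [set` box a (r0 * 2 ^+ t)] <= 4 ^ t * K0)%N.
Proof.
have [l [ul lB]] := cover_list (bdd_box a (r0 * 2 ^+ t)).
rewrite (massE ul lB).
have := Lb (filter_uniq (box a (r0 * 2 ^+ t)) ul) (a := a) (t := t).
rewrite filter_all => /(_ isT); apply: leq_trans.
rewrite big_filter [leqRHS]big_mkcond /=; apply: leq_sum => x _.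
rewrite mem_setE; case: ifP => [_|]; first by case: (_ \in _); rewrite ?muln1 ?muln0.
by rewrite -[box _ _ x]/(x \in box _ _) => ->; rewrite muln0.
Qed.

(** With [y - p] for [y], this is the set of those l for which y lies on the half-open side p + [0,
    s) d of l + P; this accounts for the minus sign. *)
Definition seg y d (s : R) : set (R * R) :=
  [set x | exists2 t, 0 <= t < s & x = y - t *: d].

Lemma bdd_seg y d s : bdd (seg y d s).
Proof.
exists (`|y.1| + `|y.2| + `|s| * (`|d.1| + `|d.2|)) => _ [t /andP[t0 ts] ->].
have tn (q : R) : `|t * q| <= `|s| * `|q|.
  by rewrite normrM ler_wpM2r// !ger0_norm// ?ltW//; exact: le_lt_trans ts.
have := tn d.1; have := tn d.2 => h1 h2.
have := normr_ge0 y.1; have := normr_ge0 y.2 => h3 h4.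
have h5 : 0 <= `|s| * `|d.1| by rewrite mulr_ge0.
have h6 : 0 <= `|s| * `|d.2| by rewrite mulr_ge0.
rewrite /box !coordE !subr0; apply/andP.
by split; rewrite (le_trans (ler_normB _ _))//; lra.
Qed.

Lemma seg_inj d (s t : R) : d != 0 -> s *: d = t *: d -> s = t.
Proof.
move=> dn /eqP; rewrite -subr_eq0 -scalerBl scaler_eq0 (negbTE dn) orbF.
by rewrite subr_eq0 => /eqP.
Qed.

Lemma mass_segD y d s t : 0 <= s -> 0 <= t -> d != 0 ->
  mass (seg y d (s + t)) = (mass (seg y d s) + mass (seg (y - s *: d)%R d t))%N.
Proof.
move=> s0 t0 dn; rewrite -massU; [|exact: bdd_seg|exact: bdd_seg|].
  congr mass; apply/seteqP; split=> x.
    move=> [q /andP[q0 qs] ->]; have [h|h] := ltP q s; [left|right].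
      by exists q => //; rewrite q0.
    by exists (q - s); [lra|vring].
  by case=> -[q /andP[q0 qs] ->]; [exists q|exists (s + q)]; [lra|by []|lra|vring].
apply/seteqP; split => // x [[p /andP[p0 ps] ->] [q /andP[q0 qs]]].
move/eqP; rewrite -subr_eq0 => /eqP e.
have : (p - (s + q)) *: d = 0.
  by rewrite -[RHS]oppr0 -e; vring.
by move/eqP; rewrite scaler_eq0 (negbTE dn) orbF => /eqP; lra.
Qed.

Lemma mass_seg_small y d : d != 0 ->
  exists2 e, 0 < e & forall s, 0 < s <= e -> mass (seg y d s) = L y.
Proof.
move=> dn; have [l [ul lP]] := cover_list (bdd_seg y d 1).
have [e [e0 eP]] : exists e : R, 0 < e /\ forall t, 0 < t < e -> y - t *: d \notin l.
  elim: l {ul lP} => [|x l [e [e0 IH]]]; first by exists 1.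
  have [[t [t0 tx]]|nt] := pselect (exists t : R, 0 < t /\ y - t *: d = x).
    exists (Num.min e t); rewrite lt_min e0 t0; split => // q.
    rewrite lt_min inE negb_or => /and3P[q0 qe qt]; rewrite IH ?q0// andbT.
    apply/negP => /eqP; rewrite -tx => /addrI/oppr_inj/(seg_inj dn) e'.
    by rewrite e' ltxx in qt.
  exists e; split => // q /andP[q0 qe]; rewrite inE negb_or IH ?q0// andbT.
  by apply/negP => /eqP h; apply: nt; exists q.
exists (Num.min e 1); first by rewrite lt_min e0 ltr01.
move=> s /andP[s0]; rewrite le_min => /andP[se s1].
rewrite -mass_set1 /mass; apply/esym/fsbig_widen.
  by move=> _ ->; exists 0; rewrite ?lexx ?scale0r ?subr0.
move=> x [[t /andP[t0 ts] ex] /= xy]; apply: contrapT => /eqP Lx.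
have te : 0 < t < e.
  rewrite lt_neqAle t0 andbT (lt_le_trans ts se) andbT.
  by apply/eqP => t00; apply: xy; rewrite ex -t00 scale0r subr0.
have := eP t te; rewrite -ex => /negP; apply.
by apply: lP => //; exists t => //; rewrite t0 (lt_le_trans ts s1).
Qed.

End Mass.

(** * Translation equations for the masses of segments *)

Section SegmentEquation.
Context {R : realType}.
Implicit Types (u v w x y z a b c d e f : R * R).
Variables (L : R * R -> nat) (r0 : R) (K0 : nat).
Hypotheses (r0_gt0 : 0 < r0) (Lb : box_bound L r0 K0).
Local Notation mass := (mass L).

(* Sliding the segment a little trades the point [y] for [y - e]. *)
Lemma seg_eq_fdiff e w : e != 0 ->
  (forall y, mass (seg y e 1) = mass (seg (y - w) e 1)) ->
  fdiff e (fdiff w (fun x => (L x)%:Z)) = (fun=> 0).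
Proof.
move=> e0 H; apply/funext => x.
have [s1 s10 H1] := mass_seg_small r0_gt0 Lb x e0.
have [s2 s20 H2] := mass_seg_small r0_gt0 Lb (x - e) e0.
have [s3 s30 H3] := mass_seg_small r0_gt0 Lb (x - w) e0.
have [s4 s40 H4] := mass_seg_small r0_gt0 Lb (x - w - e) e0.
pose s := Num.min (Num.min s1 s2) (Num.min s3 s4).
have s0 : 0 < s by rewrite !lt_min s10 s20 s30 s40.
have [h1 h2 h3 h4] : [/\ s <= s1, s <= s2, s <= s3 & s <= s4].
  by split; rewrite /s !ge_min lexx ?orbT.
have slide y : (mass (seg y e s) + mass (seg (y - s *: e)%R e 1) =
                mass (seg y e 1) + mass (seg (y - e)%R e s))%N.
  rewrite -(mass_segD r0_gt0 Lb)// ?(ltW s0)// addrC (mass_segD r0_gt0 Lb)// ?(ltW s0)//.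
  by rewrite scale1r.
have := slide x; have := slide (x - w).
rewrite H1 ?s0// H2 ?s0// H3 ?s0// H4 ?s0// (H x) (H (x - s *: e)).
rewrite (_ : x - s *: e - w = x - w - s *: e); last by vring.
rewrite /fdiff (_ : x - e - w = x - w - e); last by vring.
lia.
Qed.

Lemma seg_sub_box y d s : 0 <= s -> seg y d s `<=` [set` box y (s * (`|d.1| + `|d.2|))].
Proof.
move=> s0 x [t /andP[t0 ts] xE]; apply/andP; rewrite {x}xE !coordE.
have E (q p : R) : `|q - t * p - q| = t * `|p|.
  by rewrite addrAC subrr add0r normrN normrM ger0_norm.
have h1 (p : R) : t * `|p| <= s * `|p| by rewrite ler_wpM2r// ltW.
rewrite !E mulrDr; split.
  by rewrite (le_trans (h1 _))// lerDl mulr_ge0.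
by rewrite (le_trans (h1 _))// lerDr mulr_ge0.
Qed.

Lemma mass_seg_le d s : 0 <= s -> exists K, forall y, (mass (seg y d s) <= K)%N.
Proof.
move=> s0; have [t st] := pow2_ge r0_gt0 (s * (`|d.1| + `|d.2|)).
exists (4 ^ t * K0)%N => y; apply: leq_trans (mass_box r0_gt0 Lb t y).
apply: (mass_sub r0_gt0 Lb); first exact: bdd_box.
move=> x /(seg_sub_box s0)/andP[h1 h2].
by apply/andP; split; [exact: le_trans h1 st|exact: le_trans h2 st].
Qed.

Lemma exists_max (T : Type) (g : T -> nat) (t0 : T) B : (forall t, (g t <= B)%N) ->
  exists t, forall s, (g s <= g t)%N.
Proof.
move=> gB; pose P n := `[< exists t, g t = n >].
have exP : exists n, P n by exists (g t0); apply/asboolP; exists t0.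
have PB n : P n -> (n <= B)%N by move=> /asboolP[t <-].
case: (ex_maxnP exP PB) => n /asboolP[t <-] H; exists t => s.
by apply: H; apply/asboolP; exists s.
Qed.

Section LengthComparison.
Variables (d w : R * R) (h : R) (N : nat).
Hypotheses (d0 : d != 0) (h0 : 0 < h).
Let mu y n := mass (seg y d (n%:R * h)).
Hypothesis Hmu : forall y, (mu y N.+1 <= mu (y - w)%R N)%N.

Let muD y n m : mu y (n + m) = (mu y n + mu (y - (n%:R * h) *: d)%R m)%N.
Proof. by rewrite /mu natrD mulrDl (mass_segD r0_gt0 Lb)// mulr_ge0// ltW. Qed.

Let mu_sum y n : mu y n = (\sum_(i < n) mu (y - (i%:R * h) *: d)%R 1)%N.
Proof.
elim: n => [|n IH]; last by rewrite big_ord_recr -IH /= -muD addn1.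
rewrite big_ord0 /mu mul0r (_ : seg _ _ _ = set0); first exact: mass_set0.
by apply/seteqP; split => // x [t /andP[t0 /(le_lt_trans t0)]]; rewrite ltxx.
Qed.

(** Cut into pieces of length h, both sides count the piece at offset i + j once for each i < m and
    j < n. *)
Let mu_swap y n m : (\sum_(j < n) mu (y - (j%:R * h) *: d)%R m =
  \sum_(j < m) mu (y - (j%:R * h) *: d)%R n)%N.
Proof.
under eq_bigr => j _ do rewrite mu_sum.
under [RHS]eq_bigr => j _ do rewrite mu_sum.
rewrite exchange_big; apply: eq_bigr => i _; apply: eq_bigr => j _.
by congr mu; vring.
Qed.

Let mu_mono y y' n n' t : y' = y + t *: d -> 0 <= t -> n%:R * h + t <= n'%:R * h ->
  (mu y n <= mu y' n')%N.
Proof.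
move=> -> t0 tn; apply: (mass_sub r0_gt0 Lb); first exact: bdd_seg.
by move=> _ [s /andP[s0 sn] ->]; exists (s + t); [lra|vring].
Qed.

(** The segment lies in N + 1 windows of length n + N. By [mu_swap] their total is a sum over
    windows of length N + 1; [Hmu] shortens these to N, and swapping back leaves only N windows of
    length n + N, all inside one of length n + 2 N. *)
Let mu_step y n : exists y', (N.+1 * mu y n <= N * mu y' (n + 2 * N))%N.
Proof.
pose y0 := y + (N%:R * h) *: d.
exists (y0 - w).
have le1 : (\sum_(j < N.+1) mu y n <= \sum_(j < N.+1) mu (y0 - (j%:R * h) *: d)%R (n + N))%N.
  apply: leq_sum => j _; apply: (mu_mono (t := (N - j)%:R * h)).
  - by rewrite /y0 natrB ?ltnS -1?ltnS//; vring.
  - by rewrite mulr_ge0// ltW.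
  - rewrite -mulrDl ler_pM2r// -natrD ler_nat; lia.
have le2 : (\sum_(j < n + N) mu (y0 - (j%:R * h) *: d)%R N.+1 <=
            \sum_(j < n + N) mu (y0 - w - (j%:R * h) *: d)%R N)%N.
  apply: leq_sum => j _; apply: leq_trans (Hmu _) _.
  by rewrite (_ : y0 - (j%:R * h) *: d - w = y0 - w - (j%:R * h) *: d)//; vring.
have le3 : (\sum_(j < N) mu (y0 - w - (j%:R * h) *: d)%R (n + N) <=
            \sum_(j < N) mu (y0 - w)%R (n + 2 * N))%N.
  apply: leq_sum => j _; apply: (mu_mono (t := j%:R * h)).
  - by vring.
  - by rewrite mulr_ge0// ltW.
  - rewrite -mulrDl ler_pM2r// -natrD ler_nat; have := ltn_ord j; lia.
move: le1 le3; rewrite !sum_nat_const !card_ord => le1 le3.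
rewrite (leq_trans le1)// mu_swap (leq_trans le2)// mu_swap//.
Qed.

Lemma length_comparison x : L x = 0%N.
Proof.
have nh0 n : 0 <= n%:R * h by rewrite mulr_ge0// ltW.
have [c cP] := mass_seg_le d (nh0 (2 * N)%N).
(* For a maximiser z at fixed n, [mu_step] reads (N + 1) mu z n <= N (mu z n + c), where c bounds
   the mass of the extra length 2 N; the resulting bound N c does not depend on n. *)
have mu_bnd (yn : (R * R) * nat) : (mu yn.1 yn.2 <= N * c)%N.
  case: yn => y n /=.
  have [K KP] := mass_seg_le d (nh0 n).
  have [z zmax] := exists_max (g := mu ^~ n) 0 KP.
  apply: leq_trans (zmax y) _.
  have [z' z'P] := mu_step z n.
  move: z'P; rewrite muD; have := zmax z'; have := cP (z' - (n%:R * h) *: d).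
  rewrite -/(mu _ _) mulSn mulnDr => h1 h2.
  have := leq_mul (leqnn N) h1; have := leq_mul (leqnn N) h2; lia.
(* Now the maximum is over positions and lengths together, and [mu_step] compares N + 1 times it
   with at most N times it. *)
have [[y n] ymax] := exists_max (0, 0%N) mu_bnd.
have [z zP] := mu_step y n.
have := ymax (z, (n + 2 * N)%N) => /= h1.
have y0 : mu y n = 0%N by have := leq_mul (leqnn N) h1; move: zP; rewrite mulSn; lia.
have := ymax (x, 1%N); rewrite /= y0 leqn0 => /eqP mu0.
apply/eqP; rewrite -leqn0 -mu0; apply: (mass_pos r0_gt0 Lb); first exact: bdd_seg.
by exists 0; rewrite ?scale0r ?subr0// mul1r lexx h0.
Qed.

End LengthComparison.

Lemma seg_eq_length d w k k' : d != 0 -> 0 <= k' -> k' < k ->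
  (forall y, mass (seg y d k) = mass (seg (y - w) d k')) -> forall x, L x = 0%N.
Proof.
move=> d0 k'0 kk H.
(* The choice gives k' (N + 1) <= N k: when k is cut into N + 1 pieces of length h, the length k' is
   covered by N of them. *)
pose N := (Num.truncn (k' / (k - k'))).+1.
have Nk : k' <= N%:R * (k - k').
  by rewrite -ler_pdivrMr ?subr_gt0// ltW// truncnS_gt.
have N0 : N.+1%:R != 0 :> R by rewrite pnatr_eq0.
pose h := k / N.+1%:R.
have hE : N.+1%:R * h = k by rewrite /h mulrC divfK.
have h0 : 0 < h by rewrite divr_gt0// (le_lt_trans k'0).
apply: (length_comparison (d := d) (w := w) (N := N) d0 h0) => y.
rewrite hE H; apply: (mass_sub r0_gt0 Lb); first exact: bdd_seg.
move=> _ [s /andP[s0 sk] ->]; exists s => //; rewrite s0 (lt_le_trans sk)//.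
by move: hE; rewrite -natr1; nra.
Qed.

End SegmentEquation.

(** * Disjoint segments against quadratic growth *)

Section Density.
Context {R : realType}.
Implicit Types (u v w x y z a b c d e f : R * R).
Variables (L : R * R -> nat) (r0 : R) (K0 : nat).
Hypotheses (r0_gt0 : 0 < r0) (Lb : box_bound L r0 K0).
Local Notation mass := (mass L).

(* If no non-zero multiple of [w] lay in [R e + Z f], the translates by multiples of [w] of the segments
   supplied by [z] would be disjoint, and too numerous for their total mass to be quadratic in the radius. *)
Lemma seg_density e f w (I : finType) (z : I -> R * R) : cross e f != 0 ->
  (forall y, mass (seg y e 1) = mass (seg (y - w) e 1)) ->
  (forall p q : nat, exists i, L (z i + p%:R *: e + q%:R *: f) != 0%N) ->
  exists r q : int, exists2 t : R, r != 0 & r%:~R *: w = t *: e + q%:~R *: f.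
Proof.
move=> ef H Hz; apply: contrapT => nrel.
have e0 : e != 0 by exact: cross_neq0l ef.
have Hr y (r : nat) : mass (seg (y - r%:R *: w) e 1) = mass (seg y e 1).
  elim: r => [|r IH]; first by rewrite scale0r subr0.
  by rewrite -IH [RHS]H; congr mass; congr seg; rewrite -natr1; vring.
pose nm u : R := `|u.1| + `|u.2|.
have nm0 u : 0 <= nm u by rewrite addr_ge0.
have [u' u'P] := pow2_ge r0_gt0 (nm e + nm f).
pose u := u'.+1.
(* The mass of the box of radius r0 2^(t+u) allows at most #|I| 4^u K0 times n n segments in all,
   where n = 2^t. [M] exceeds this factor and does not depend on t, so t can then be taken large
   enough to absorb the shifts by r w with r < M. *)
pose M := (#|I| * (4 ^ u * K0)).+1.
pose C0 : R := \sum_i nm (z i) + nm e + M%:R * nm w.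
have [t tP] := pow2_ge r0_gt0 C0.
pose n := (2 ^ t)%N.
pose F i (s : 'I_M * 'I_n * 'I_n) :=
  seg (z i + s.1.2%:R *: e + s.2%:R *: f - s.1.1%:R *: w) e 1.
have Fbnd (a1 e1 f1 w1 q0 : R) (r p q : nat) : (r < M)%N -> (p < n)%N -> (q < n)%N ->
    0 <= q0 < 1 -> `|a1 + p%:R * e1 + q%:R * f1 - r%:R * w1 - q0 * e1| <=
      `|a1| + `|e1| + M%:R * `|w1| + n%:R * (`|e1| + `|f1|).
  move=> rM pn qn /andP[q00 q01].
  have h (m m' : nat) (b : R) : (m < m')%N -> `|m%:R * b| <= m'%:R * `|b|.
    by move=> mm; rewrite normrM normr_nat ler_wpM2r// ler_nat ltnW.
  have h' : `|q0 * e1| <= `|e1| by rewrite normrM ler_piMl// ger0_norm// ltW.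
  have := h _ _ e1 pn; have := h _ _ f1 qn; have := h _ _ w1 rM.
  by move: (lexx `|a1|) h'; rewrite !ler_norml; lra.
have nE : n%:R = 2 ^+ t :> R by rewrite natrX.
have zC (i : I) : nm (z i) + nm e + M%:R * nm w <= r0 * 2 ^+ t.
  apply: le_trans tP; apply: lerD => //; apply: lerD => //.
  rewrite (bigD1 i)// -[leLHS]addr0; apply: lerD => //.
  by apply: sumr_ge0 => j _; exact: nm0.
have rad : r0 * 2 ^+ t + n%:R * (nm e + nm f) <= r0 * 2 ^+ (t + u).
  have : n%:R * (nm e + nm f) <= n%:R * (r0 * 2 ^+ u') by rewrite ler_wpM2l.
  have : r0 * 2 ^+ t <= n%:R * (r0 * 2 ^+ u').
    by rewrite nE mulrCA ler_wpM2l ?(ltW r0_gt0)// ler_peMr ?exprn_ge0// exprn_ege1// ler1n.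
  by rewrite /u addnS exprS exprD -nE; lra.
have FB i s : F i s `<=` [set` box 0 (r0 * 2 ^+ (t + u))].
  case: s => [[r p] q] _ [q0 q01 ->]; apply/andP; rewrite !coordE !subr0.
  have := zC i; rewrite /nm in rad *.
  have M0 : 0 <= M%:R :> R by [].
  have w10 : 0 <= M%:R * `|w.1| by rewrite mulr_ge0.
  have w20 : 0 <= M%:R * `|w.2| by rewrite mulr_ge0.
  have ef1 : 0 <= n%:R * (`|e.1| + `|f.1|) by rewrite mulr_ge0// addr_ge0.
  have ef2 : 0 <= n%:R * (`|e.2| + `|f.2|) by rewrite mulr_ge0// addr_ge0.
  have z1 := normr_ge0 (z i).1; have z2 := normr_ge0 (z i).2.
  have e1 := normr_ge0 e.1; have e2 := normr_ge0 e.2.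
  move=> zc; split.
    by apply: le_trans (Fbnd _ _ _ _ _ _ _ _ (ltn_ord r) (ltn_ord p) (ltn_ord q) q01) _; lra.
  by apply: le_trans (Fbnd _ _ _ _ _ _ _ _ (ltn_ord r) (ltn_ord p) (ltn_ord q) q01) _; lra.
(* A common point puts (r - r') w in R e + Z f, so r = r' by [nrel]; the f-coordinate then gives q =
   q', and half-openness of segments of length 1 gives p = p'. *)
have FI i s s' : F i s `&` F i s' !=set0 -> s = s'.
  case: s s' => [[r p] q] [[r' p'] q'] [_ [[t1 /= t1P ->] [t2 /= t2P]]] E.
  have E1 : r%:R *: w - r'%:R *: w =
      (p%:R - t1 - p'%:R + t2) *: e + (q%:R - q'%:R) *: f.
    rewrite -[LHS](_ : z i + p%:R *: e + q%:R *: f - t1 *: e - (z i + p%:R *: e + q%:R *: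
        f - r%:R *: w - t1 *: e) - r'%:R *: w = _); last by vring.
    by rewrite E; vring.
  have rr : r = r'.
    apply/val_inj/eqP/negPn/negP => /= rr'; apply: nrel.
    exists (r%:Z - r'%:Z), (q%:Z - q'%:Z), (p%:R - t1 - p'%:R + t2).
      by rewrite subr_eq0 eqz_nat.
    by rewrite !intrB scalerBl E1.
  move: E1; rewrite {}rr subrr => E1.
  have qq : q = q'.
    have := congr1 (cross e) E1; rewrite (_ : cross e 0 = 0); last by rewrite /cross !coordE; ring.
    rewrite (_ : cross e _ = (q%:R - q'%:R) * cross e f); last by rewrite /cross !coordE; ring.
    move/esym/eqP; rewrite mulf_eq0 (negbTE ef) orbF subr_eq0 eqr_nat => /eqP.
    exact: val_inj.
  move: E1; rewrite {}qq subrr scale0r addr0 => /esym/eqP.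
  rewrite scaler_eq0 (negbTE e0) orbF => /eqP pp.
  have p1 : p%:R < p'.+1%:R :> R by rewrite -natr1; lra.
  have p2 : p'%:R < p.+1%:R :> R by rewrite -natr1; lra.
  congr (_, _, _); apply/val_inj/eqP; move: p1 p2; rewrite !ltr_nat !ltnS => p1 p2.
  by rewrite eqn_leq p1 p2.
have mge y : (L y <= mass (seg y e 1))%N.
  apply: (mass_pos r0_gt0 Lb); first exact: bdd_seg.
  by exists 0; rewrite ?lexx ?ltr01// scale0r subr0.
(* Invariance under w transports the mass found at r = 0 to every r, so each of the M n n triples
   accounts for at least one unit of mass. *)
have le1 : (\sum_(s : 'I_M * 'I_n * 'I_n) 1 <= \sum_(s : 'I_M * 'I_n * 'I_n) \sum_i mass (F i s))%N.
  apply: leq_sum => s _; have [i iP] := Hz s.1.2 s.2.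
  rewrite (bigD1 i)//= ltn_addr// /F Hr; apply: leq_trans (mge _).
  by rewrite lt0n.
move: le1; rewrite exchange_big sum1_card /= leqNgt => /negP; apply.
apply: (@leq_ltn_trans (\sum_(i : I) 4 ^ (t + u) * K0)%N).
  apply: leq_sum => i _; apply: leq_trans (mass_box r0_gt0 Lb (t + u) 0).
  by apply: (mass_disjoint r0_gt0 Lb (bdd_box _ _)); [exact: FB|exact: FI].
rewrite sum_nat_const !card_prod !card_ord expnD.
rewrite (_ : 4 ^ t = n * n)%N; last by rewrite /n -expnMn.
have n0 : (0 < n)%N by rewrite expn_gt0.
rewrite (_ : (#|I| * _ = #|I| * (4 ^ u * K0) * (n * n))%N); last by ring.
by rewrite -[ltnRHS]mulnA ltn_pmul2r ?muln_gt0 ?n0.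
Qed.

End Density.

(** * Two independent periods from the segment equations *)

Section Core.
Context {R : realType}.
Implicit Types (u v w x y z a b c d f : R * R) (F G : R * R -> int).

Lemma fdiff0 w : fdiff w (fun=> 0) = (fun=> 0) :> (R * R -> int).
Proof. by apply/funext => x; rewrite /fdiff subrr. Qed.

Lemma fdiff_per w F : fdiff w F = (fun=> 0) -> per F w.
Proof. by move=> /fdiff_eq0P H; exists 1%N => // x; rewrite scale1r. Qed.

(** Iterating [per_split] replaces each equation by one of its two factors, provided that x is a
    period for every way of choosing; [S] holds the choices already made and [cs] those still to
    come. *)
Lemma per_pairs (s : seq ((R * R) * (R * R))) (S : seq (R * R)) x :
  (forall cs G, all2 (fun w p => (w == p.1) || (w == p.2)) cs s -> bnd_fun G ->
    (forall w, w \in cs ++ S -> fdiff w G = (fun=> 0)) -> per G x) ->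
  forall F, bnd_fun F ->
  (forall p, p \in s -> fdiff p.1 (fdiff p.2 F) = (fun=> 0)) ->
  (forall w, w \in S -> fdiff w F = (fun=> 0)) -> per F x.
Proof.
elim: s S => [|[a b] s IH] S HG F bF Fs FS; first exact: (HG [::]).
pose C F := [/\ bnd_fun F,
  forall p, p \in s -> fdiff p.1 (fdiff p.2 F) = (fun=> 0) &
  forall w, w \in S -> fdiff w F = (fun=> 0)].
apply: (@per_split _ C a b) => //.
- move=> {bF Fs FS}F w [bF Fs FS]; split; first exact: bnd_fdiff.
    by move=> p /Fs Fp; rewrite (fdiffC p.2) fdiffC Fp fdiff0.
  by move=> v /FS Fv; rewrite fdiffC Fv fdiff0.
- by move=> G [].
- move=> G [bG Gs GS] Ga; apply: (IH (a :: S)) => // [cs G' cs1 bG' G'c|w].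
    apply: (HG (a :: cs)) => //=; first by rewrite eqxx.
    move=> w wc; apply: G'c; move: wc; rewrite !inE !mem_cat inE.
    by case/or3P => ->; rewrite ?orbT.
  by rewrite inE => /predU1P[->//|]; exact: GS.
- move=> G [bG Gs GS] Gb; apply: (IH (b :: S)) => // [cs G' cs1 bG' G'c|w].
    apply: (HG (b :: cs)) => //=; first by rewrite eqxx orbT.
    move=> w wc; apply: G'c; move: wc; rewrite !inE !mem_cat inE.
    by case/or3P => ->; rewrite ?orbT.
  by rewrite inE => /predU1P[->//|]; exact: GS.
- by split => // p ps; apply: Fs; rewrite inE ps orbT.
- by apply: (Fs (a, b)); rewrite inE eqxx.
Qed.

Lemma span_fdiff_per a b w w' G x : spanQ a b x -> cross w w' != 0 ->
  spanQ a b w -> spanQ a b w' -> fdiff w G = (fun=> 0) ->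
  fdiff w' G = (fun=> 0) -> per G x.
Proof.
move=> ax ww aw aw' Gw Gw'.
by apply: (spanQ_per (fdiff_per Gw) (fdiff_per Gw')); exact: spanQ_basis ax.
Qed.

Variables (L : R * R -> nat) (r0 : R) (K0 : nat).
Hypotheses (r0_gt0 : 0 < r0) (Lb : box_bound L r0 K0).
Let ZL x := (L x)%:Z.

Lemma bnd_mult : bnd_fun ZL.
Proof.
exists K0%:Z => x; rewrite /ZL ger0_norm// lez_nat.
have := @Lb 0%N x [:: x] isT; rewrite big_seq1 expn0 mul1n; apply.
by rewrite /= /box !subrr normr0 mulr1 ltW.
Qed.

Lemma locfin_mult : locfin ZL.
Proof.
move=> r; have [t rt] := pow2_ge r0_gt0 r.
exists (4 ^ t * K0)%N => l ul lP.
have := @Lb t 0 l ul; rewrite -sum1_size => h; apply: leq_trans (h _).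
  rewrite !big_seq leq_sum// => x /lP[_ _]; rewrite /ZL lt0n.
  by apply: contra => /eqP ->.
apply/allP => x /lP[h1 h2 _]; rewrite /box !coordE !subr0.
by rewrite !(le_trans _ rt).
Qed.

Variables (m : nat) (V : nat -> R * R).
(** For a centrally symmetric polygon [V k] is the diagonal between opposite vertices. Changing the
    sign of [V k.+1] exchanges [e k] and [t k]. *)
Let e k := 2^-1 *: (V k - V k.+1).
Let t k := 2^-1 *: (V k + V k.+1).
Hypotheses (m3 : (3 <= m)%N) (VN : V m = - V 0).
Hypothesis e_indep : forall k l, (k < l < m)%N -> cross (e k) (e l) != 0.
Hypothesis t_indep : forall k l, (k < l < m)%N -> cross (t k) (t l) != 0.
Hypothesis seg_eq : forall k, (k < m)%N -> forall y,
  mass L (seg y (e k) 1) = mass L (seg (y - t k) (e k) 1).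

Let half (u : R * R) : 2 *: (2^-1 *: u) = u.
Proof. by rewrite scalerA divff// scale1r. Qed.

Lemma mult_fdiff_eq0 k : (k < m)%N -> fdiff (e k) (fdiff (t k) ZL) = (fun=> 0).
Proof.
move=> km; apply: (seg_eq_fdiff r0_gt0 Lb); last exact: seg_eq.
have [k0|k1] := posnP k.
  by apply: (cross_neq0l (@e_indep k 1 _)); rewrite k0 /= (ltn_trans _ m3).
have : cross (e 0) (e k) != 0 by apply: e_indep; rewrite k1.
by apply: contra_neq => ->; rewrite /cross !coordE; ring.
Qed.

(** Two of the three chosen vectors are both among the [e] or both among the [t], hence independent,
    and they span the same rational plane as [a] and [b]. *)
Lemma rational_case a b : (forall k, (k <= m)%N -> spanQ a b (V k)) ->
  forall x, spanQ a b x -> per ZL x.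
Proof.
move=> aV x ax.
have ae k : (k < m)%N -> spanQ a b (e k).
  by move=> km; apply: spanQ_half; rewrite half//; apply: spanQB; apply: aV => //; exact: ltnW.
have at_ k : (k < m)%N -> spanQ a b (t k).
  by move=> km; apply: spanQ_half; rewrite half//; apply: spanQD; apply: aV => //; exact: ltnW.
have m0 : (0 < m)%N by exact: leq_trans m3.
have m1 : (1 < m)%N by exact: leq_trans m3.
apply: (@per_pairs [:: (e 0, t 0); (e 1, t 1); (e 2, t 2)]%N [::]) => //.
- move=> [|w0 [|w1 [|w2 [|? ?]]]] G //=; rewrite ?andbF// andbT.
  move=> /and3P[h0 h1 h2] _ HG.
  have G0 : fdiff w0 G = (fun=> 0) by apply: HG; rewrite !inE eqxx.
  have G1 : fdiff w1 G = (fun=> 0) by apply: HG; rewrite !inE eqxx orbT.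
  have G2 : fdiff w2 G = (fun=> 0) by apply: HG; rewrite !inE eqxx !orbT.
  have ee k l := @span_fdiff_per a b (e k) (e l) G x ax.
  have tt k l := @span_fdiff_per a b (t k) (t l) G x ax.
  case/orP: h0 => /eqP h0; case/orP: h1 => /eqP h1; case/orP: h2 => /eqP h2; subst w0 w1 w2;
  solve [ by apply: (ee 0 1)%N => //; [exact: e_indep|exact: ae|exact: ae]
        | by apply: (ee 0 2)%N => //; [exact: e_indep|exact: ae|exact: ae]
        | by apply: (ee 1 2)%N => //; [exact: e_indep|exact: ae|exact: ae]
        | by apply: (tt 0 1)%N => //; [exact: t_indep|exact: at_|exact: at_]
        | by apply: (tt 0 2)%N => //; [exact: t_indep|exact: at_|exact: at_]
        | by apply: (tt 1 2)%N => //; [exact: t_indep|exact: at_|exact: at_] ].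
- exact: bnd_mult.
- move=> p; rewrite !inE => /or3P[] /eqP -> /=; exact: mult_fdiff_eq0.
Qed.


Let tE k : t k = V k - e k. Proof. by rewrite /t /e; apply: pairP; rewrite !coordE; field. Qed.

Section IrrationalCase.
Hypothesis irr : forall a b, cross a b != 0 ->
  ~ forall k, (k <= m)%N -> spanQ a b (V k).

(** Modulo the rational plane, a known [e k] gives V (k+1) = V k and a known [t k] gives V (k+1) = -
    V k. *)
Let all_from0 a b : (forall k, (k < m)%N -> spanQ a b (e k) \/ spanQ a b (t k)) ->
  forall k, (k <= m)%N -> spanQ a b (V k - V 0) \/ spanQ a b (V k + V 0).
Proof.
move=> H; elim => [_|k IH km].
  by left; rewrite subrr; exists 0, 0; rewrite !rmorph0 !scale0r addr0.
case: (IH (ltnW km)) => h; case: (H k km) => /(spanQZ 2); rewrite rmorph_nat half => h'.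
- by left; have := spanQB h h'; congr spanQ; vring.
- by right; have := spanQB h' h; congr spanQ; vring.
- by right; have := spanQB h h'; congr spanQ; vring.
- by left; have := spanQB h' h; congr spanQ; vring.
Qed.

Let irr' a b : cross a b != 0 -> 
  (forall k, (k < m)%N -> spanQ a b (e k) \/ spanQ a b (t k)) -> ~ spanQ a b (V 0).
Proof.
move=> ab H V0; apply: (irr ab) => k km.
case: (all_from0 H km) => h; first by have := spanQD h V0; congr spanQ; vring.
by have := spanQB h V0; congr spanQ; vring.
Qed.

(** The mixed difference keeps its non-zero value along the lattice of its periods, so at each
    lattice point one of its four terms is non-zero; this supplies the finite family of
    [seg_density]. *)
Let recur i j x : (i < m)%N -> (j < m)%N ->
  fdiff (t i) (fdiff (t j) ZL) x != 0 ->
  fdiff (e i) (fdiff (t i) (fdiff (t j) ZL)) = (fun=> 0) ->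
  fdiff (e j) (fdiff (t i) (fdiff (t j) ZL)) = (fun=> 0) ->
  forall p q : nat, exists c : bool * bool,
    L (x - (if c.1 then t i else 0) - (if c.2 then t j else 0) + p%:R *: e i + q%:R *: e j) != 0%N.
Proof.
move=> im jm hx /fdiff_eq0P pi /fdiff_eq0P pj p q.
have : fdiff (t i) (fdiff (t j) ZL) (x + p%:R *: e i + q%:R *: e j) != 0.
  by rewrite (periodM pj) (periodM pi).
apply: contraPP => /forallNP H; apply/negP/negPn/eqP.
have Z (c : bool * bool) : ZL (x - (if c.1 then t i else 0) - (if c.2 then t j else 0) + p%:R *:
    e i + q%:R *: e j) = 0.
  by have /negP/negPn/eqP := H c; rewrite /ZL => ->.
rewrite /fdiff; have := Z (true, true); have := Z (true, false); have := Z (false, true);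
    have := Z (false, false).
rewrite /= !subr0; set y := x + p%:R *: e i + q%:R *: e j.
rewrite (_ : x - t i + p%:R *: e i + q%:R *: e j = y - t i); last by rewrite /y; vring.
rewrite (_ : x - t j + p%:R *: e i + q%:R *: e j = y - t j); last by rewrite /y; vring.
rewrite (_ : x - t i - t j + p%:R *: e i + q%:R *: e j = y - t i - t j); last by rewrite /y; vring.
by move=> -> -> -> ->.
Qed.

Let swapQ a b x : spanQ a b x -> spanQ b a x.
Proof. by move=> [r [s ->]]; exists s, r; rewrite addrC. Qed.

(** Dividing by r shows that w has a rational f-coordinate; this passes to v, which equals w up to
    sign modulo the rational plane. *)
Let cross_half (E f : R * R) w (r q : int) (p : R) v : r != 0 -> r%:~R *: w = p *: E + q%:~R *: f ->
  spanQ E f (w - v) \/ spanQ E f (w + v) ->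
  exists (s : rat) (p' : R), v = p' *: E + ratr s *: f.
Proof.
move=> r0' rw.
have R0 : r%:~R != 0 :> R by rewrite intr_eq0.
have wE : w = (p / r%:~R) *: E + ratr (q%:~R / r%:~R) *: f.
  have -> : ratr (q%:~R / r%:~R) = q%:~R / r%:~R :> R by rewrite fmorph_div /= !ratr_int.
  apply: (scalerI R0); rewrite rw; apply: pairP; rewrite !coordE; field => //.
by case=> -[a [b wv]]; [exists (q%:~R / r%:~R - b), (p / r%:~R - ratr a)
  |exists (b - q%:~R / r%:~R), (ratr a - p / r%:~R)];
  [rewrite -[v](subKr w) wv|rewrite -[v](addKr w) wv]; rewrite {1}wE rmorphB /=; vring.
Qed.

Lemma mixed_fdiff_eq0 i j : (i < m)%N -> (j < m)%N -> i != j ->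
  fdiff (t i) (fdiff (t j) ZL) = (fun=> 0).
Proof.
move=> im jm ij; apply: contrapT => /eqP.
set h := fdiff _ _ => h0.
have {h0} [x hx] : exists x, h x != 0.
  apply: contrapT => /forallNP H; move/negP: h0; apply; apply/eqP/funext => x.
  by have /negP/negPn/eqP := H x.
have eij : cross (e i) (e j) != 0.
  move: ij; rewrite neq_ltn => /orP[ij|ji]; first by apply: e_indep; rewrite ij.
  rewrite (_ : cross _ _ = - cross (e j) (e i)); last by rewrite /cross; ring.
  by rewrite oppr_eq0 e_indep// ji.
have eji : cross (e j) (e i) != 0.
  by rewrite (_ : cross _ _ = - cross (e i) (e j)) ?oppr_eq0// /cross; ring.
have hi : fdiff (e i) h = (fun=> 0).
  by rewrite /h (fdiffC (t i)) fdiffC mult_fdiff_eq0// fdiff0.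
have hj : fdiff (e j) h = (fun=> 0).
  by rewrite /h fdiffC mult_fdiff_eq0// fdiff0.
have fh : locfin h by do 2 apply: locfin_fdiff; exact: locfin_mult.
(* Either [t k] is a period of h, or the non-zero function (1 - T_{t k}) h has period [e k]; in both
   cases e i and e j are periods as well, and [locfin_period] applies. *)
have ek k : (k < m)%N -> spanQ (e i) (e j) (e k) \/ spanQ (e i) (e j) (t k).
  move=> km; have [tk|/eqP tk] := pselect (fdiff (t k) h = (fun=> 0)).
    by right; exact: (locfin_period fh hx eij (fdiff_per hi) (fdiff_per hj) (fdiff_per tk)).
  have {tk} [y hy] : exists y, fdiff (t k) h y != 0.
    apply: contrapT => /forallNP H; move/negP: tk; apply; apply/eqP/funext => y.
    by have /negP/negPn/eqP := H y.
  left; apply: (locfin_period (locfin_fdiff (t k) fh) hy eij); apply: fdiff_per.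
  - by rewrite fdiffC hi fdiff0.
  - by rewrite fdiffC hj fdiff0.
  - rewrite /h (fdiffC (t k) (t i)) (fdiffC (t k) (t j)) (fdiffC (e k) (t i)) (fdiffC (e k) (t j)).
    by rewrite mult_fdiff_eq0// !fdiff0.
have near k : (k < m)%N -> spanQ (e i) (e j) (e k) ->
    spanQ (e i) (e j) (t k - V 0) \/ spanQ (e i) (e j) (t k + V 0).
  move=> km ak; case: (all_from0 ek (ltnW km)) => H; [left|right];
    by have := spanQB H ak; rewrite tE; congr spanQ; vring.
have rec := recur im jm hx hi hj.
have [r [q [p r0' rq]]] := seg_density r0_gt0 Lb eij (seg_eq im) rec.
have rec' p' q' : exists c : bool * bool, L (x - (if c.1 then t i else 0) -
    (if c.2 then t j else 0) + p'%:R *: e j + q'%:R *: e i) != 0%N.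
  by have [c cP] := rec q' p'; exists c; rewrite addrAC.
have [r' [q' [p' r0'' rq']]] := seg_density r0_gt0 Lb eji (seg_eq jm) rec'.
(* The relation for [t i] makes the e j-coordinate of [V 0] rational, that for [t j] its e
   i-coordinate. Together they put [V 0] into the rational plane, against [irr']. *)
have [s [g E1]] := cross_half r0' rq (near i im (spanQl _ _)).
have : spanQ (e j) (e i) (t j - V 0) \/ spanQ (e j) (e i) (t j + V 0).
  by case: (near j jm (spanQr _ _)) => /swapQ; [left|right].
move=> /(cross_half r0'' rq') [s' [g' E2]].
apply: (irr' eij ek); exists s', s.
rewrite {1}E1; congr (_ + _); congr (_ *: _).
have : cross (V 0) (e j) = g * cross (e i) (e j) by rewrite E1 /cross !coordE; ring.
have -> : cross (V 0) (e j) = ratr s' * cross (e i) (e j) by rewrite E2 /cross !coordE; ring.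
by move/(mulIf eij) => ->.
Qed.

Lemma irrational_case : exists a b, [/\ cross a b != 0, per ZL a & per ZL b].
Proof.
have m1 : (1 < m)%N by exact: leq_trans m3.
have [all0|] := pselect (forall k, (k < m)%N -> fdiff (t k) ZL = (fun=> 0)).
  exists (t 0%N), (t 1%N); split; first exact: t_indep.
    by apply: fdiff_per; apply: all0; exact: ltnW.
  by apply: fdiff_per; exact: all0.
move/existsNP => [i] /not_implyP[im] fi.
have {fi} [x fx] : exists x, fdiff (t i) ZL x != 0.
  apply: contrapT => /forallNP H; apply: fi; apply/funext => y.
  by have /negP/negPn/eqP := H y.
(* For m = 3 the index c may be m itself; c < m follows only once m is known to be even. *)
have [a [b [c [ab bc c3 [ai bi ci]]]]] : exists a b c : nat,
    [/\ (a < b)%N, (b < c)%N, (c <= 3)%N & [/\ a != i, b != i & c != i]].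
  case: i im {x fx} => [|[|[|i]]] _; first by exists 1, 2, 3.
  - by exists 0, 2, 3.
  - by exists 0, 1, 3.
  - by exists 0, 1, 2.
have bm : (b < m)%N by exact: leq_trans (leq_trans bc c3) m3.
have am : (a < m)%N by exact: ltn_trans ab bm.
have tab : cross (t a) (t b) != 0 by apply: t_indep; rewrite ab.
have ft k : (k < m)%N -> k != i -> per (fdiff (t i) ZL) (t k).
  by move=> km ki; apply: fdiff_per; exact: mixed_fdiff_eq0.
have fin := locfin_period (locfin_fdiff (t i) locfin_mult) fx tab (ft a am ai) (ft b bm bi).
have Wt k : (k < m)%N -> k != i -> spanQ (t a) (t b) (t k).
  by move=> km ki; apply: fin; exact: ft.
have We : spanQ (t a) (t b) (e i).
  by apply: fin; apply: fdiff_per; exact: mult_fdiff_eq0.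
(* Each [t k] in the plane reverses the sign from V k to V (k+1); the single step at i, where [e i]
   is in the plane, keeps it. Hence the correction of the exponent by one beyond i. *)
have sgn k : (k <= m)%N -> spanQ (t a) (t b) (V k - (-1) ^+ (k + (i < k)%N) *: V 0).
  elim: k => [_|k IH km].
    by rewrite ltn0 expr0 scale1r subrr; exists 0, 0; rewrite rmorph0 !scale0r addr0.
  have {IH} := IH (ltnW km); have [->|ki] := eqVneq k i.
    rewrite ltnn addn0 ltnSn addn1 !exprS !mulN1r opprK => H.
    by have := spanQB H (spanQZ 2 We); rewrite rmorph_nat half; congr spanQ; vring.
  rewrite (_ : (i < k.+1)%N = (i < k)%N); last by rewrite ltnS leq_eqVlt eq_sym (negbTE ki).
  rewrite addSn exprS mulN1r => H.
  by have := spanQB (spanQZ 2 (Wt _ km ki)) H; rewrite rmorph_nat half; congr spanQ; vring.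
(* For odd m the sign at m is +, so V m = - V 0 would put 2 V 0 into the plane. *)
have m_even : ~~ odd m.
  apply/negP => om; apply: (irr' tab).
    by move=> k km; have [->|ki] := eqVneq k i; [left|right; exact: Wt].
  have := sgn m (leqnn m); rewrite im addn1 -signr_odd /= om expr0 scale1r VN.
  move=> /spanQN H; apply: spanQ_half; move: H; congr spanQ.
  by vring.
have cm : (c < m)%N.
  rewrite (leq_ltn_trans c3)// ltn_neqAle m3 andbT.
  by apply: contraNneq m_even => <-.
(* No vector belongs to all three pairs, so every choice contains two different, hence independent,
   ones. *)
have Wper y : spanQ (t a) (t b) y -> per ZL y.
  move=> Wy; apply: (@per_pairs [:: (t a, t b); (t b, t c); (t a, t c)] [::]) => //.
  - move=> [|w0 [|w1 [|w2 [|? ?]]]] G //=; rewrite ?andbF// andbT.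
    move=> /and3P[h0 h1 h2] _ HG.
    have G0 : fdiff w0 G = (fun=> 0) by apply: HG; rewrite !inE eqxx.
    have G1 : fdiff w1 G = (fun=> 0) by apply: HG; rewrite !inE eqxx orbT.
    have G2 : fdiff w2 G = (fun=> 0) by apply: HG; rewrite !inE eqxx !orbT.
    have tt k l := @span_fdiff_per (t a) (t b) (t k) (t l) G y Wy.
    have tac : cross (t a) (t c) != 0 by apply: t_indep; rewrite (ltn_trans ab).
    have tbc : cross (t b) (t c) != 0 by apply: t_indep; rewrite bc.
    case/orP: h0 => /eqP h0; case/orP: h1 => /eqP h1; case/orP: h2 => /eqP h2; subst w0 w1 w2;
    solve [ by apply: (tt a b) => //; exact: Wt
          | by apply: (tt a c) => //; exact: Wt
          | by apply: (tt b c) => //; exact: Wt ].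
  - exact: bnd_mult.
  - have [ab' ac' bc'] : [/\ a != b, a != c & b != c].
      by rewrite !neq_ltn ab bc (ltn_trans ab bc).
    move=> p; rewrite !inE => /or3P[] /eqP -> /=; exact: mixed_fdiff_eq0.
by exists (t a), (t b); split => //; apply: Wper; [exact: spanQl|exact: spanQr].
Qed.

End IrrationalCase.

Lemma two_periods : exists a b, [/\ cross a b != 0, per ZL a & per ZL b].
Proof.
have [[a [b [ab H]]]|irr] := pselect (exists a b, cross a b != 0 /\
    forall k, (k <= m)%N -> spanQ a b (V k)).
  exists a, b; split => //; apply: (rational_case H); [exact: spanQl|exact: spanQr].
by apply: irrational_case => a b ab H; apply: irr; exists a, b.
Qed.

End Core.

(** * Convex hulls of finite sets *)

Section Convexity.
Context {R : realType}.
Implicit Types (u v w x y z a b c d p q o : R * R) (A P : set (R * R)) (s : seq (R * R)).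

Definition cvx A := forall x y (t : R), 0 <= t <= 1 -> A x -> A y ->
  A (t *: x + (1 - t) *: y).

Lemma cvxP A : @convex_set R (R * R)%type A <-> cvx A.
Proof.
split => [cA x y t /andP[t0 t1] Ax Ay|cA x y l xA yA].
  by have := cA x y (Itv01 t0 t1) (mem_set Ax) (mem_set Ay) => /set_mem.
apply/mem_set; apply: cA; [by rewrite ge0 le1|exact: set_mem|exact: set_mem].
Qed.

Lemma hull_cvx A : cvx (convex_hull A).
Proof.
move=> x y t t01 Px Py B [cB AB].
by apply: ((cvxP B).1 cB) => //; [exact: Px|exact: Py].
Qed.

Lemma sub_hull A : A `<=` convex_hull A.
Proof. exact: sub_smallest. Qed.

Lemma hull_sub A B : cvx B -> A `<=` B -> convex_hull A `<=` B.
Proof. by move=> cB AB x; apply; split => //; apply: (cvxP B).2. Qed.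

Lemma cvx_cross_ge d (c : R) : cvx [set x | c <= cross d x].
Proof.
move=> x y t t01 /= cx cy.
rewrite (_ : cross d _ = t * cross d x + (1 - t) * cross d y); last by rewrite /cross !coordE; ring.
by nra.
Qed.

(** A compact model of the hull is built by adding one point at a time: the cone from v over a
    compact set K is a continuous image of [0, 1] x K. *)
Lemma hull_closed s : closed (convex_hull [set` s]).
Proof.
suff [K [cK vK sK Ks]] : exists K, [/\ compact K, cvx K, [set` s] `<=` K &
    forall B, cvx B -> [set` s] `<=` B -> K `<=` B].
  rewrite (_ : convex_hull _ = K).
    by apply: compact_closed => //; exact: (@norm_hausdorff _ (R * R)%type).
  apply/seteqP; split; first exact: hull_sub.
  by apply: Ks; [exact: hull_cvx|exact: sub_hull].
elim: s => [|v s [K [cK vK sK Ks]]].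
  by exists set0; split => [||x|B _ _ x] //; exact: compact0.
(* The product with an empty K would be empty and miss v. *)
have [K0|/eqP/set0P[k0 Kk0]] := pselect (K = set0).
  exists [set v]; split.
  - exact: compact_set1.
  - by move=> x y t _ -> ->; rewrite -scalerDl addrC subrK scale1r.
  - move=> x; rewrite /= inE => /predU1P[->//|xs]; have := sK x xs.
    by rewrite K0.
  - by move=> B _ H _ ->; apply: H; rewrite /= inE eqxx.
pose f (ty : R * (R * R)) : R * R := (1 - ty.1) *: v + ty.1 *: ty.2.
exists (f @` (`[0, 1] `*` K)); split.
- apply: continuous_compact; last by apply: compact_setX => //; exact: segment_compact.
  apply: continuous_subspaceT => ty.
  apply: cvgD; apply: cvgZ.
  + by apply: cvgB; [exact: cvg_cst|exact: cvg_fst].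
  + exact: cvg_cst.
  + exact: cvg_fst.
  + exact: cvg_snd.
- move=> _ _ t t01 [[t1 y1] [/= h1 Ky1] <-] [[t2 y2] [/= h2 Ky2] <-].
  move: h1 h2; rewrite !in_itv /= => h1 h2.
  (* The weight that the combination gives to K; when it vanishes the point is v itself, and any
     point of K serves as a witness. *)
  pose T := t * t1 + (1 - t) * t2.
  have T0 : 0 <= T by rewrite /T; nra.
  have T1 : T <= 1 by rewrite /T; nra.
  have a0 : 0 <= t * t1 by nra.
  have b0 : 0 <= (1 - t) * t2 by nra.
  move: T0; rewrite le_eqVlt => /predU1P[T0|T0].
    exists (0, k0) => /=; first by split => //; rewrite /= in_itv /= lexx ler01.
    have a00 : t * t1 = 0 by rewrite /T in T0; lra.
    have b00 : (1 - t) * t2 = 0 by rewrite /T in T0; lra.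
    rewrite /f /=; apply: pairP; rewrite !coordE.
      rewrite -[RHS](_ : v.1 + (t * t1) * (y1.1 - v.1)
          + ((1 - t) * t2) * (y2.1 - v.1) = _); last by ring.
      by rewrite a00 b00; ring.
    rewrite -[RHS](_ : v.2 + (t * t1) * (y1.2 - v.2)
        + ((1 - t) * t2) * (y2.2 - v.2) = _); last by ring.
    by rewrite a00 b00; ring.
  exists (T, (t * t1 / T) *: y1 + (1 - t * t1 / T) *: y2) => /=.
    split; first by rewrite /= in_itv /= ltW.
    apply: vK => //; rewrite divr_ge0 ?(ltW T0)//= ler_pdivrMr// mul1r.
    by rewrite /T; lra.
  have Tn : T != 0 by rewrite gt_eqF.
  rewrite /f /=; apply: pairP; rewrite !coordE.
    rewrite -[LHS](_ : (1 - T) * v.1 + t * t1 * y1.1 + (T - t * t1) * y2.1 = _); last by field.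
    by rewrite /T; ring.
  rewrite -[LHS](_ : (1 - T) * v.2 + t * t1 * y1.2 + (T - t * t1) * y2.2 = _); last by field.
  by rewrite /T; ring.
- move=> x; rewrite /= inE => /predU1P[->|xs].
    exists (0, k0); first by split => //; rewrite /= in_itv /= lexx ler01.
    by rewrite /f /=; vring.
  exists (1, x); first by split; [rewrite /= in_itv /= lexx ler01|exact: sK].
  by rewrite /f /=; vring.
- move=> B cB sB _ [[t y] [/= t01 Ky] <-]; rewrite /f /= addrC.
  apply: (cB); first by move: t01; rewrite in_itv.
    by apply: (Ks B cB _ y Ky) => x xs; apply: sB; rewrite /= inE xs orbT.
  by apply: sB; rewrite /= inE eqxx.
Qed.

Lemma nbhs_boxP x A : nbhs x A <-> exists2 r : R, 0 < r & forall y, box x r y -> A y.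
Proof.
split=> [/nbhs_ballP[r /= r0 H]|[r r0 H]].
  exists (r / 2); first by rewrite divr_gt0.
  move=> y /andP[h1 h2]; apply: H; split; rewrite /ball /= distrC.
    by rewrite (le_lt_trans h1)// ltr_pdivrMr// ltr_pMr// ltr1n.
  by rewrite (le_lt_trans h2)// ltr_pdivrMr// ltr_pMr// ltr1n.
apply/nbhs_ballP; exists r => //= y [h1 h2]; apply: H.
by apply/andP; split; rewrite distrC ltW.
Qed.

(** The homothety of centre x and ratio t maps the box around y onto the asserted one. *)
Lemma cvx_box A y (r : R) x (t : R) : cvx A -> (forall u, box y r u -> A u) -> A x ->
  0 < t <= 1 -> forall u, box (t *: y + (1 - t) *: x) (t * r) u -> A u.
Proof.
move=> cA yA Ax /andP[t0 t1] u /andP[h1 h2].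
have tn : t != 0 by rewrite gt_eqF.
rewrite (_ : u = t *: (t^-1 *: (u - (1 - t) *: x)) + (1 - t) *: x); last first.
  by apply: pairP; rewrite !coordE; field.
apply: cA => //; first by rewrite (ltW t0) t1.
have S (m n k : R) : `|m - (t * n + (1 - t) * k)| <= t * r -> `|t^-1 * (m - (1 - t) * k) - n| <= r.
  move=> h; rewrite -(ler_pM2l t0) -{1}(gtr0_norm t0) -normrM; apply: le_trans h.
  by rewrite le_eqVlt; apply/orP; left; apply/eqP; congr `|_|; field.
apply: yA; apply/andP; rewrite !coordE; split; apply: S.
  by move: h1; rewrite !coordE.
by move: h2; rewrite !coordE.
Qed.

End Convexity.

(** * Local shape of a convex set just ahead of a point *)

Section Germ.
Context {R : realType}.
Implicit Types (u v w x y z a b c d p q o : R * R) (A P : set (R * R)) (s : seq (R * R)).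

Definition perp d : R * R := (- d.2, d.1).

Lemma cross_perp d : cross d (perp d) = d.1 ^+ 2 + d.2 ^+ 2.
Proof. by rewrite /cross /perp /=; ring. Qed.

Lemma sqnorm_gt0 d : d != 0 -> 0 < d.1 ^+ 2 + d.2 ^+ 2.
Proof.
move=> d0; rewrite lt_neqAle addr_ge0 ?sqr_ge0// andbT eq_sym paddr_eq0 ?sqr_ge0//.
rewrite !sqrf_eq0; apply: contra d0 => /andP[/eqP h1 /eqP h2].
by apply/eqP; apply: pairP; rewrite coordE.
Qed.

Lemma crossD d u v : cross d (u + v) = cross d u + cross d v.
Proof. by rewrite /cross !coordE; ring. Qed.
Lemma crossZ d (t : R) u : cross d (t *: u) = t * cross d u.
Proof. by rewrite /cross !coordE; ring. Qed.
Lemma crossN d u : cross d (- u) = - cross d u.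
Proof. by rewrite /cross !coordE; ring. Qed.
Lemma crossdd d : cross d d = 0.
Proof. by rewrite /cross; ring. Qed.
Lemma cross_antisym d u : cross u d = - cross d u.
Proof. by rewrite /cross; ring. Qed.

Definition crossE := (crossD, crossZ, crossN, crossdd).

Lemma same_level d x y : d != 0 -> cross d x = cross d y -> exists t : R, x = y + t *: d.
Proof.
move=> d0 xy; have n0 := lt0r_neq0 (sqnorm_gt0 d0).
pose t := (d.1 * (x.1 - y.1) + d.2 * (x.2 - y.2)) / (d.1 ^+ 2 + d.2 ^+ 2).
exists t; have pn : cross d (perp d) != 0 by rewrite cross_perp.
have := cross_basis (x - y) pn; rewrite (_ : cross d (x - y) = 0); last first.
  by rewrite !crossE xy subrr.
rewrite mul0r scale0r addr0 => e; rewrite -[LHS](subrKC y) {1}e; congr (_ + _ *: _).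
by rewrite cross_perp /t; congr (_ / _); rewrite /cross /=; ring.
Qed.

Definition germ P d z (Q : set (R * R)) := exists2 e0 : R, 0 < e0 &
  forall e, 0 < e < e0 -> exists2 h : R, 0 < h &
    forall w, box (z + e *: d) h w -> (P w <-> Q w).

Lemma cross_box d x w (h : R) : box x h w ->
  `|cross d w - cross d x| <= (`|d.1| + `|d.2|) * h.
Proof.
move=> /andP[h1 h2]; rewrite (_ : _ - _ = d.1 * (w.2 - x.2) - d.2 * (w.1 - x.1)); last first.
  by rewrite /cross; ring.
rewrite (le_trans (ler_normB _ _))// !normrM mulrDl lerD// ler_wpM2l//.
Qed.

Lemma box_center x (h : R) : 0 <= h -> box x h x.
Proof. by move=> h0; rewrite /box !subrr normr0 h0. Qed.

(* The triangle spanned by the segment and [o] fills the half-plane on the side of [o]. *)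
Lemma edge_germ P d p o (k t : R) : cvx P -> P p -> P (p + k *: d) -> P o ->
  cross d (o - p) != 0 -> 0 <= t < k ->
  exists2 e0 : R, 0 < e0 & forall e, 0 < e < e0 -> exists2 h : R, 0 < h &
    forall w, box (p + t *: d + e *: d) h w ->
      0 <= cross d (w - p) * cross d (o - p) -> P w.
Proof.
move=> cP Pp Pq Po D0 /andP[t0 tk]; set D := cross d (o - p) in D0 *.
have k0 : 0 < k by exact: le_lt_trans tk.
exists (k - t); first by rewrite subr_gt0.
move=> e /andP[e0 ek]; set x := p + t *: d + e *: d.
(* Up to the factor k, these are the barycentric coordinates of w at p + k d and at o in the
   triangle with third vertex p. *)
pose al w := cross (w - p) (o - p) / D; pose be w := cross d (w - p) / D.
have wE w : w = (1 - be w - al w / k) *: p + (al w / k) *: (p + k *: d) + be w *: o.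
  have := cross_basis (w - p) D0; rewrite -/(al w) -/(be w) => h.
  rewrite -[LHS](subrKC p) h; apply: pairP; rewrite !coordE; field; exact: lt0r_neq0.
have alx : al x = t + e.
  rewrite /al /x (_ : cross _ _ = (t + e) * D) ?mulfK//.
  by rewrite /D /cross !coordE; ring.
have bex : be x = 0.
  by rewrite /be /x (_ : cross _ _ = 0) ?mul0r// /cross !coordE; ring.
pose C := (`|(o - p).1| + `|(o - p).2| + (`|d.1| + `|d.2|)) / `|D|.
have D1 : 0 < `|D| by rewrite normr_gt0.
have C0 : 0 <= C by rewrite divr_ge0// !addr_ge0.
have near w h : box x h w -> `|al w - (t + e)| <= C * h /\ `|be w| <= C * h.
  move=> xw; have h0 : 0 <= h.
    by move: xw => /andP[+ _]; apply: le_trans.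
  have c1 := cross_box (o - p) xw; have c2 := cross_box d xw.
  split.
    rewrite -alx /al -mulrBl normrM normfV ler_pdivrMr// /C mulrAC divfK ?gt_eqF//.
    rewrite (_ : cross (w - p) _ - _ = - (cross (o - p) w - cross (o - p) x));
        last by rewrite /cross !coordE; ring.
    by rewrite normrN (le_trans c1)// ler_wpM2r// lerDl addr_ge0.
  rewrite -[be w]subr0 -bex /be -mulrBl normrM normfV ler_pdivrMr// /C mulrAC divfK ?gt_eqF//.
  rewrite (_ : cross d (w - p) - _ = cross d w - cross d x); last by rewrite /cross !coordE; ring.
  by rewrite (le_trans c2)// ler_wpM2r// lerDr addr_ge0.
(* An error g in both coordinates costs at most g (1 + k) against the margins t + e and k - (t + e),
   so all three barycentric coordinates stay non-negative. *)
pose g := Num.min (t + e) (k - (t + e)) / (1 + k).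
have m0 : 0 < Num.min (t + e) (k - (t + e)) by rewrite lt_min; apply/andP; split; lra.
have g0 : 0 < g by rewrite divr_gt0//; lra.
exists (g / (1 + C)); first by rewrite divr_gt0//; lra.
move=> w /near[n1 n2] side.
have Cg : C * (g / (1 + C)) <= g.
  by rewrite mulrCA ler_piMr ?(ltW g0)// ler_pdivrMr; lra.
have gm : g * (1 + k) = Num.min (t + e) (k - (t + e)) by rewrite divfK// gt_eqF//; lra.
have be0 : 0 <= be w.
  by rewrite /be -(@pmulr_lge0 _ (D ^+ 2)) ?exprn_even_gt0// expr2 mulrA divfK.
have m1 : g * (1 + k) <= t + e by rewrite gm ge_min lexx.
have m2 : g * (1 + k) <= k - (t + e) by rewrite gm ge_min lexx orbT.
have be1 : be w <= g by move: n2; rewrite ler_norml; lra.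
have gk : 0 < g * k by exact: mulr_gt0.
have al0 : 0 <= al w by move: n1; rewrite ler_norml; lra.
have alk : 0 <= al w / k by rewrite divr_ge0// ltW.
have ga0 : 0 <= 1 - be w - al w / k.
  have : (1 - be w) * k - al w >= 0.
    have : be w * k <= g * k by rewrite ler_wpM2r// ltW.
    by move: n1; rewrite ler_norml; lra.
  move=> h; have : 0 <= ((1 - be w) * k - al w) / k by rewrite divr_ge0// ltW.
  by rewrite mulrBl mulfK ?gt_eqF.
have [b1|b1] := eqVneq (be w) 1.
  have a0 : al w / k = 0 by lra.
  by rewrite (_ : w = o)// [LHS](wE w) b1 a0; vring.
have b1' : 0 < 1 - be w by rewrite subr_gt0 lt_neqAle b1; lra.
rewrite (wE w) (_ : _ + _ = be w *: o + (1 - be w) *: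
    (((1 - be w - al w / k) / (1 - be w)) *: p + (1 - (1 - be w - al w / k) / (1 - be w)) *:
        (p + k *: d))).
  apply: (cP) => //; first by rewrite be0; lra.
  apply: (cP) => //; rewrite divr_ge0 ?(ltW b1')//= ler_pdivrMr// mul1r.
  by lra.
have n3 := lt0r_neq0 b1'; have n4 := lt0r_neq0 k0.
by apply: pairP; rewrite !coordE; field; rewrite n3 n4.
Qed.

End Germ.

(** * The two sides of a convex set parallel to a direction *)

Section EdgeEquation.
Context {R : realType}.
Implicit Types (u v w x y z a b c d p q o : R * R) (P A : set (R * R)).

(* The part of [P] extremal to the right of [d] is the segment [p, p + k d]; it may be a point. *)
Definition edge P d p (k : R) := [/\ 0 <= k, P p, P (p + k *: d),
  forall x, P x -> cross d p <= cross d x &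
  forall x, P x -> cross d x = cross d p -> exists2 t : R, 0 <= t <= k & x = p + t *: d].

Section Germs.
Variables (P : set (R * R)) (d p p' o : R * R) (k k' r : R).
Hypotheses (cP : cvx P) (clP : closed P) (r0 : 0 < r) (Po : forall u, box o r u -> P u).
(** The opposite side is p' + [0, k'] d, so that both sides are followed in direction d; as an edge
    for - d it starts at its far end p' + k' d. *)
Hypotheses (d0 : d != 0) (Ed : edge P d p k) (Ed' : edge P (- d) (p' + k' *: d) k').

Let Poo : P o. Proof. by apply: Po; rewrite box_center// ltW. Qed.

Lemma edge_levels : cross d p < cross d o < cross d p'.
Proof.
have [_ _ _ m _] := Ed; have [_ _ _ m' _] := Ed'.
have n0 := sqnorm_gt0 d0.
pose N := `|d.1| + `|d.2| + 1.
have N0 : 0 < N by rewrite /N; have := normr_ge0 d.1; have := normr_ge0 d.2; lra.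
have near (e : R) : `|e| = r / N -> P (o + e *: perp d).
  move=> e0; apply: Po; apply/andP; rewrite !coordE; split.
    rewrite addrAC subrr add0r normrM e0 mulrAC ler_pdivrMr// ler_pM2l// normrN.
    by rewrite /N; have := normr_ge0 d.1; lra.
  rewrite addrAC subrr add0r normrM e0 mulrAC ler_pdivrMr// ler_pM2l//.
  by rewrite /N; have := normr_ge0 d.2; lra.
have rN : 0 < r / N by rewrite divr_gt0.
have h1 := m _ (near (- (r / N)) _); have h2 := m' _ (near (r / N) _).
have {h1} := h1 ltac:(by rewrite normrN gtr0_norm).
have {h2} := h2 ltac:(by rewrite gtr0_norm).
have s0 : 0 < r / N * (d.1 ^+ 2 + d.2 ^+ 2) by rewrite mulr_gt0.
have -> u : cross (- d) u = - cross d u by rewrite /cross !coordE; ring.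
have -> u : cross (- d) u = - cross d u by rewrite /cross !coordE; ring.
by rewrite !crossE cross_perp; lra.
Qed.

Let outside z (e0 : R) : 0 < e0 -> (forall e, 0 < e < e0 -> ~ P (z + e *: d)) ->
  germ P d z set0.
Proof.
move=> e00 H; exists e0 => // e /H nP.
have : open (~` P) by exact: closed_openC.
rewrite openE => /(_ _ nP) /nbhs_boxP[h h0 hP]; exists h => // w /hP.
by split.
Qed.

Lemma germ_right (t : R) : 0 <= t < k ->
  germ P d (p + t *: d) [set w | cross d p <= cross d w].
Proof.
move=> tk; have [_ Pp Pq m _] := Ed; have /andP[l1 _] := edge_levels.
have D0 : cross d (o - p) > 0 by rewrite !crossE subr_gt0.
have [e0 e00 H] := edge_germ cP Pp Pq Poo (lt0r_neq0 D0) tk.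
exists e0 => // e /H[h h0 hP]; exists h => // w /hP Hw; split; first exact: m.
by move=> l; apply: Hw; rewrite mulr_ge0 ?(ltW D0)// !crossE subr_ge0.
Qed.

Lemma germ_left (t : R) : 0 <= t < k' ->
  germ P d (p' + t *: d) [set w | cross d w <= cross d p'].
Proof.
move=> tk; have [_ Pq Pp m _] := Ed'; have /andP[_ l1] := edge_levels.
have D0 : cross d (o - p') < 0 by rewrite !crossE subr_lt0.
have Pp' : P p' by move: Pp; rewrite scalerN addrK.
have [e0 e00 H] := edge_germ cP Pp' Pq Poo (ltr0_neq0 D0) tk.
have N u : cross (- d) u = - cross d u by rewrite /cross !coordE; ring.
exists e0 => // e /H[h h0 hP]; exists h => // w /hP Hw; split.
  by move/m; rewrite !N !crossE mulr0 addr0 lerN2.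
by move=> l; apply: Hw; rewrite mulr_le0 ?(ltW D0)// !crossE subr_le0.
Qed.

(** Off the half-open sides, the points just ahead of z are inside P or outside it, never on a side
    parallel to d. The far end of a side is rightly left out, as moving ahead from it leaves P. *)
Lemma germ_const z : (forall t : R, 0 <= t < k -> z <> p + t *: d) ->
  (forall t : R, 0 <= t < k' -> z <> p' + t *: d) ->
  germ P d z set0 \/ germ P d z setT.
Proof.
have [k0 Pp Pq m f] := Ed; have [k'0 Pq' Pp' m' f'] := Ed'.
have N u : cross (- d) u = - cross d u by rewrite /cross !coordE; ring.
have m'' x : P x -> cross d x <= cross d p'.
  by move/m'; rewrite !N !crossE mulr0 addr0 lerN2.
move=> nE nE'.
have lev e : cross d (z + e *: d) = cross d z by rewrite !crossE mulr0 addr0.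
have [l1|l1|l1] := ltgtP (cross d z) (cross d p).
- left; apply: (outside ltr01) => e _ /m; rewrite lev; lra.
- have [l2|l2|l2] := ltgtP (cross d z) (cross d p'); last 2 first.
  + left; apply: (outside ltr01) => e _ /m''; rewrite lev; lra.
  + left; have [t zE] := same_level d0 l2.
    have nt : t < 0 \/ k' <= t.
      have [t0|t0] := ltP t 0; [by left|right]; have [tk|//] := ltP t k'.
      by case: (nE' t _ zE); rewrite t0.
    have H e : 0 < e -> (t < 0 -> e < - t) -> ~ P (z + e *: d).
      move=> e0 et Pz; have [|s sk E] := f' _ Pz.
        by rewrite !N lev l2 !crossE mulr0 addr0.
      have : (t + e - (k' - s)) *: d = 0.
        transitivity ((z + e *: d) - (p' + k' *: d + s *: - d)); first by rewrite zE; vring.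
        by rewrite E subrr.
      move/eqP; rewrite scaler_eq0 (negbTE d0) orbF => /eqP; case: nt => [/[dup] /et|]; lra.
    case: nt => [t0|t0]; [apply: (@outside _ (- t))|apply: (outside ltr01)] => [|e|e];
        rewrite ?oppr_gt0//.
      by move=> /andP[e0 e1]; exact: H.
    by move=> /andP[e0 e1]; apply: H => //; lra.
  have /andP[lo1 lo2] := edge_levels.
  (* At a level strictly between the sides, an interior point is obtained by combining o with p or
     p', whichever brings it to that level. *)
  have [y0 [h [h0 yP yl]]] : exists y0, exists h : R, [/\ 0 < h, forall u, box y0 h u ->
      P u & cross d y0 = cross d z].
    have [lol|lol] := leP (cross d o) (cross d z).
      pose s := (cross d p' - cross d z) / (cross d p' - cross d o).
      have s0 : 0 < s by rewrite divr_gt0; lra.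
      have s1 : s <= 1 by rewrite ler_pdivrMr; lra.
      exists (s *: o + (1 - s) *: p'), (s * r); split; first exact: mulr_gt0.
        apply: (cvx_box cP Po); last by rewrite s0.
        by move: Pp'; rewrite scalerN addrK.
      by rewrite !crossE /s; field; lra.
    pose s := (cross d z - cross d p) / (cross d o - cross d p).
    have s0 : 0 < s by rewrite divr_gt0; lra.
    have s1 : s <= 1 by rewrite ler_pdivrMr; lra.
    exists (s *: o + (1 - s) *: p), (s * r); split; first exact: mulr_gt0.
      by apply: (cvx_box cP Po) => //; rewrite s0.
    by rewrite !crossE /s; field; lra.
  have [t0 yE] := same_level d0 yl.
  have [A|nA] := pselect (forall e0 : R, 0 < e0 ->
      exists2 e, 0 < e < e0 & P (z + e *: d)); last first.
    left; move/existsNP: nA => [e0 /not_implyP[e00 H]]; apply: (outside e00) => e ee Pe.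
    by apply: H; exists e.
  right.
  (* A point of the line between a point of P and the interior point y0 = z + t0 d is interior; e1
     is chosen on the other side of z + e d from y0. *)
  have mid (e1 e : R) : P (z + e1 *: d) -> 0 < (e - e1) / (t0 - e1) <= 1 -> t0 - e1 != 0 ->
      exists2 h : R, 0 < h & forall w, box (z + e *: d) h w -> (P w <-> setT w).
    move=> P1 sP n1; set s := _ / _ in sP.
    have /andP[s0 _] := sP.
    exists (s * h); first exact: mulr_gt0.
    move=> w; rewrite (_ : z + e *: d = s *: y0 + (1 - s) *: (z + e1 *: d)).
      by move=> /(cvx_box cP yP P1 sP).
    rewrite yE /s; apply: pairP; rewrite !coordE; field => //.
  have [t00|t00] := leP t0 0.
    have [e1 /andP[e10 e11] Pe1] := A 1 ltr01.
    exists e1 => // e /andP[ee0 ee1]; apply: (mid e1) => //; last lra.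
    rewrite -mulrNN -invrN !opprB divr_gt0/=; [|lra|lra].
    by rewrite ler_pdivrMr; lra.
  exists t0 => // e /andP[ee0 ee1].
  have [e1 /andP[e10 e11] Pe1] := A e ee0.
  apply: (mid e1) => //; last lra.
  by rewrite divr_gt0/=; [|lra|lra]; rewrite ler_pdivrMr; lra.
- left; have [t zE] := same_level d0 l1.
  have nt : t < 0 \/ k <= t.
    have [t0|t0] := ltP t 0; [by left|right]; have [tk|//] := ltP t k.
    by case: (nE t _ zE); rewrite t0.
  have H e : 0 < e -> (t < 0 -> e < - t) -> ~ P (z + e *: d).
    move=> e0 et Pz; have [|s sk E] := f _ Pz; first by rewrite lev.
    have : (t + e - s) *: d = 0.
      transitivity ((z + e *: d) - (p + s *: d)); first by rewrite zE; vring.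
      by rewrite E subrr.
    move/eqP; rewrite scaler_eq0 (negbTE d0) orbF => /eqP; case: nt => [/[dup] /et|]; lra.
  case: nt => [t0|t0]; [apply: (@outside _ (- t))|apply: (outside ltr01)] => [|e|e];
      rewrite ?oppr_gt0//.
    by move=> /andP[e0 e1]; exact: H.
  by move=> /andP[e0 e1]; apply: H => //; lra.
Qed.

End Germs.
End EdgeEquation.

(** * From constant multiplicity to equal masses of segments *)

Section EdgeSegments.
Context {R : realType}.
Implicit Types (u v w x y z a b c d p q o : R * R) (P A : set (R * R)).

Lemma common_eps (T : eqType) (l : seq T) (G : T -> R -> Prop) :
  (forall i, i \in l -> exists2 e0 : R, 0 < e0 & forall e, 0 < e < e0 -> G i e) ->
  exists2 e0 : R, 0 < e0 & forall i e, i \in l -> 0 < e < e0 -> G i e.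
Proof.
elim: l => [|i l IH] H; first by exists 1.
have [|e1 e10 H1] := IH; first by move=> j jl; apply: H; rewrite inE jl orbT.
have [|e2 e20 H2] := H i; first by rewrite inE eqxx.
exists (Num.min e1 e2); first by rewrite lt_min e10.
move=> j e; rewrite inE lt_min => /predU1P[->|jl] /and3P[e0 ? ?].
  by apply: H2; rewrite e0.
by apply: H1; rewrite ?e0.
Qed.

Variables (P : set (R * R)) (d p p' o : R * R) (k k' r : R).
Hypotheses (cP : cvx P) (clP : closed P) (bP : bdd P) (r_gt0 : 0 < r) (Po :
    forall u, box o r u -> P u).
Hypotheses (d0 : d != 0) (Ed : edge P d p k) (Ed' : edge P (- d) (p' + k' *: d) k').

Variables (L : R * R -> nat) (r0 : R) (K0 K : nat).
Hypotheses (r0_gt0 : 0 < r0) (Lb : box_bound L r0 K0).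
Hypothesis dense : forall a (h : R), 0 < h ->
  exists2 x, box a h x & mass L [set l | P (x - l)] = K.

(** Crossing the line y + R d just ahead of y towards larger [cross d] enters l + P if y is on its
    low side, leaves it if y is on its high side, and changes nothing otherwise. The balance is
    written without subtraction of naturals. *)
Let jump y l (S := `[< seg (y - p) d k l >]) (S' := `[< seg (y - p') d k' l >]) :
  exists2 e0 : R, 0 < e0 & forall e, 0 < e < e0 -> exists2 h : R, 0 < h &
  forall w w', box (y + e *: d) h w -> box (y + e *: d) h w' ->
    cross d w' < cross d y < cross d w ->
    (`[< P (w - l)%R >] + S' = `[< P (w' - l)%R >] + S)%N.
Proof.
have /andP[lv1 lv2] := edge_levels r_gt0 Po d0 Ed Ed'.
have tr e h w : box (y + e *: d) h w -> box (y - l + e *: d) h (w - l).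
  move=> /andP[h1 h2]; apply/andP; move: h1 h2; rewrite !coordE.
  by rewrite (_ : w.1 - l.1 - _ = w.1 - (y.1 + e * d.1)) 1?(_ :
      w.2 - l.2 - _ = w.2 - (y.2 + e * d.2)); [|ring|ring].
have [[t tk tE]|nS] := pselect (seg (y - p) d k l).
  have zE : y - l = p + t *: d by rewrite tE; vring.
  have [e0 e00 H] := germ_right cP r_gt0 Po d0 Ed Ed' tk.
  exists e0 => // e /H[h h0 hP]; exists h => // w w' bw bw' /andP[w'y yw].
  rewrite -zE in hP.
  have yl : cross d y - cross d l = cross d p by have := congr1 (cross d) zE;
      rewrite !crossE mulr0 addr0.
  have -> : S = true by apply/asboolP; exists t.
  have -> : S' = false.
    apply/asboolP => -[t' _ tE']; have := congr1 (cross d) tE'; rewrite !crossE mulr0; lra.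
  have -> : `[< P (w - l) >] = true.
    by apply/asboolP/(hP _ (tr _ _ _ bw)); rewrite /= !crossE; lra.
  have -> : `[< P (w' - l) >] = false.
    by apply/asboolP => /(hP _ (tr _ _ _ bw')); rewrite /= !crossE; lra.
  by [].
have [[t tk tE]|nS'] := pselect (seg (y - p') d k' l).
  have zE : y - l = p' + t *: d by rewrite tE; vring.
  have [e0 e00 H] := germ_left cP r_gt0 Po d0 Ed Ed' tk.
  exists e0 => // e /H[h h0 hP]; exists h => // w w' bw bw' /andP[w'y yw].
  rewrite -zE in hP.
  have yl : cross d y - cross d l = cross d p' by have := congr1 (cross d) zE;
      rewrite !crossE mulr0 addr0.
  have -> : S' = true by apply/asboolP; exists t.
  have -> : S = false by apply/asboolP.
  have -> : `[< P (w' - l) >] = true.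
    by apply/asboolP/(hP _ (tr _ _ _ bw')); rewrite /= !crossE; lra.
  have -> : `[< P (w - l) >] = false.
    by apply/asboolP => /(hP _ (tr _ _ _ bw)); rewrite /= !crossE; lra.
  by [].
have -> : S = false by apply/asboolP.
have -> : S' = false by apply/asboolP.
have [||[e0 e00 H]|[e0 e00 H]] := germ_const cP clP r_gt0 Po d0 Ed Ed' (z := y - l).
- by move=> t tk zE; apply: nS; exists t => //; rewrite -[l](subKr y) zE; vring.
- by move=> t tk zE; apply: nS'; exists t => //; rewrite -[l](subKr y) zE; vring.
- exists e0 => // e /H[h h0 hP]; exists h => // w w' /tr/hP bw /tr/hP bw' _.
  by congr (_ + _)%N; congr nat_of_bool; apply/asboolP/asboolP => [/bw|/bw'].
- exists e0 => // e /H[h h0 hP]; exists h => // w w' /tr/hP bw /tr/hP bw' _.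
  by congr (_ + _)%N; congr nat_of_bool; apply/asboolP/asboolP => _; [exact/bw'|exact/bw].
Qed.

(** The total multiplicity is K on both sides of the line, so the entries and exits of [jump],
    weighted by L, balance. *)
Lemma edge_seg_eq y : mass L (seg (y - p) d k) = mass L (seg (y - p') d k').
Proof.
have [rP rPP] := bP.
have [_ Pp _ _ _] := Ed; have [_ _ Pp' _ _] := Ed'.
have {}Pp' : P p' by move: Pp'; rewrite scalerN addrK.
pose R1 := `|d.1| + `|d.2| + 1.
have R10 : 0 < R1 by rewrite /R1; have := normr_ge0 d.1; have := normr_ge0 d.2; lra.
(* All translates that can matter within distance R1 of y; finitely many carry mass, so e and h can
   be chosen uniformly for them. *)
pose B := [set l | exists2 x, box y R1 x & P (x - l)].
have bB : bdd B.
  exists (R1 + rP + (`|y.1| + `|y.2|)) => l [x /andP[h1 h2] /rPP/andP[]].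
  have := normr_ge0 y.1; have := normr_ge0 y.2; have := lexx `|y.1|; have := lexx `|y.2|.
  move: h1 h2; rewrite /box !coordE !ler_norml => h1 h2 a1 a2 a3 a4 a5 a6.
  by apply/andP; split; lra.
have [l [ul lB]] := cover_list r0_gt0 Lb bB.
have [e0 e00 H] := common_eps (fun i (_ : i \in l) => jump y i).
pose e := Num.min e0 1 / 2.
have m0 : 0 < Num.min e0 1 by rewrite lt_min e00 ltr01.
have e_gt0 : 0 < e by rewrite divr_gt0.
have em : e < Num.min e0 1 by rewrite ltr_pdivrMr// ltr_pMr// ltr1n.
have [e_lt e_lt1] : e < e0 /\ e < 1 by move: em; rewrite lt_min => /andP[].
pose G i h := forall w w', box (y + e *: d) h w -> box (y + e *: d) h w' ->
    cross d w' < cross d y < cross d w ->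
    (`[< P (w - i)%R >] + `[< seg (y - p')%R d k' i >] = `[< P (w' - i)%R >]
        + `[< seg (y - p)%R d k i >])%N.
have [h0 h00 HG] : exists2 h0 : R, 0 < h0 & forall i h, i \in l -> 0 < h < h0 -> G i h.
  apply: common_eps => i il; have [|h h0 hP] := H i e il; first by rewrite e_gt0.
  exists h => // h' /andP[_ h'h] w w' /andP[b1 b2] /andP[b3 b4]; apply: hP;
  by apply/andP; split; exact: le_trans (ltW h'h).
pose h := Num.min h0 1 / 2.
have n0 : 0 < Num.min h0 1 by rewrite lt_min h00 ltr01.
have h_gt0 : 0 < h by rewrite divr_gt0.
have hm : h < Num.min h0 1 by rewrite ltr_pdivrMr// ltr_pMr// ltr1n.
have [h_lt h_lt1] : h < h0 /\ h < 1 by move: hm; rewrite lt_min => /andP[].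
have N0 := sqnorm_gt0 d0; set N := _ + _ in N0.
(* The perpendicular displacement by s moves a point by at most h / 2, and h' below leaves room for
   an error that cannot bring it back across the line. *)
pose s := h / (2 * R1).
have s0 : 0 < s by rewrite divr_gt0// mulr_gt0.
have sR : s * R1 = h / 2 by rewrite /s; field; exact: lt0r_neq0.
pose h' := Num.min (h / 2) (s * N / (2 * R1)).
have h'0 : 0 < h'.
  by rewrite lt_min; apply/andP; split; apply: divr_gt0 => //; exact: mulr_gt0.
have h'h : h' <= h / 2 by rewrite ge_min lexx.
have h'N : R1 * h' < s * N.
  have : h' <= s * N / (2 * R1) by rewrite ge_min lexx orbT.
  have := mulr_gt0 s0 N0 => sN.
  move=> h1; apply: (@le_lt_trans _ _ (R1 * (s * N / (2 * R1)))); first by rewrite ler_pM2l.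
  by rewrite (_ : R1 * _ = s * N / 2); [lra|field; exact: lt0r_neq0].
have side (g : R) w : `|g| = 1 -> box (y + e *: d + (g * s) *: perp d) h' w ->
    box (y + e *: d) h w /\ `|cross d w - cross d y - g * (s * N)| < s * N.
  move=> g1 bw; have gs (q : R) : `|q| <= R1 -> `|g * s * q| <= h / 2.
    by move=> qR; rewrite normrM (normrM g s) g1 mul1r (gtr0_norm s0) -sR ler_pM2l.
  split.
    have q1 : `|- d.2| <= R1 by rewrite normrN /R1; have := normr_ge0 d.1; lra.
    have q2 : `|d.1| <= R1 by rewrite /R1; have := normr_ge0 d.2; lra.
    move: bw (gs _ q1) (gs _ q2) => /andP[]; rewrite !coordE /= => b1 b2 g2 g3.
    by apply/andP; rewrite !coordE; split; move: b1 b2 g2 g3; rewrite !ler_norml; lra.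
  have := cross_box d bw; rewrite !crossE mulr0 addr0 cross_perp -/N => c1.
  rewrite (_ : _ - _ = cross d w - (cross d y + g * s * N)); last by ring.
  apply: le_lt_trans c1 _; apply: le_lt_trans h'N.
  by rewrite ler_wpM2r ?(ltW h'0)// /R1; lra.
(* The multiplicity need not be K at prescribed points, so w and w' are only approximately placed on
   the two sides. *)
have [w bw wK] := dense (y + e *: d + (1 * s) *: perp d) h'0.
have [w' bw' wK'] := dense (y + e *: d + (-1 * s) *: perp d) h'0.
have [bw1 cw] := side 1 w (normr1 _) bw.
have [bw1' cw'] := side (-1) w' ltac:(by rewrite normrN normr1) bw'.
have lev : cross d w' < cross d y < cross d w.
  by move: cw cw'; rewrite !ltr_norml; lra.
have inR1 u : box (y + e *: d) h u -> box y R1 u.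
  move=> /andP[]; rewrite !coordE => b1 b2; apply/andP.
  have ed (q : R) : `|e * q| <= `|q| by rewrite normrM ler_piMl// gtr0_norm// ltW.
  have := ed d.1; have := ed d.2; have := normr_ge0 d.1; have := normr_ge0 d.2.
  rewrite /R1; set D1 := `|d.1|; set D2 := `|d.2|.
  by move: b1 b2; rewrite !ler_norml; split; lra.
have massP u : box (y + e *: d) h u ->
    mass L [set i | P (u - i)%R] = (\sum_(i <- l) L i * `[< P (u - i)%R >])%N.
  by move=> bu; apply: (massE ul) => i Pi; apply: lB; exists u => //; exact: inR1.
have massS c (g : R) : P c -> (forall t : R, 0 <= t < g -> P (c + t *: d)) ->
    mass L (seg (y - c)%R d g) = (\sum_(i <- l) L i * `[< seg (y - c)%R d g i >])%N.
  move=> Pc Pg; apply: (massE ul) => i [t tg ->]; apply: lB; exists y;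
      first by rewrite box_center// ltW.
  by have := Pg t tg; congr P; vring.
have chord a c (g t : R) : P a -> P c -> c = a + g *: d -> 0 <= t < g -> P (a + t *: d).
  move=> Pa Pc cE /andP[t0 tg]; have g0 : 0 < g by exact: le_lt_trans tg.
  rewrite (_ : a + t *: d = (t / g) *: c + (1 - t / g) *: a).
    by apply: cP => //; rewrite divr_ge0 ?(ltW g0)//= ler_pdivrMr// mul1r ltW.
  by rewrite cE; apply: pairP; rewrite !coordE; field; exact: lt0r_neq0.
have [[_ _ Pq _ _] [_ Pq' _ _ _]] := (Ed, Ed').
rewrite (massS _ _ Pp (fun t => chord _ _ _ t Pp Pq erefl)).
rewrite (massS _ _ Pp' (fun t => chord _ _ _ t Pp' Pq' erefl)).
apply/eqP; rewrite -(eqn_add2l (mass L [set i | P (w' - i)])) wK' -{1}wK' -wK.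
rewrite (massP w)// (massP w')// -!big_split /=; apply/eqP; rewrite big_seq [RHS]big_seq.
apply: eq_bigr => i il; rewrite -!mulnDr; congr muln; apply/esym.
by apply: (HG i h) => //; rewrite h_gt0.
Qed.

End EdgeSegments.

(** * Extremal vertices and edges of a polygon *)

Section Vertices.
Context {R : realType}.
Implicit Types (u v w x y z a b c d f p q o : R * R) (P A : set (R * R)) (s : seq (R * R)).

Definition lexmin s d f p := p \in s /\ forall v, v \in s ->
  cross d p < cross d v \/ cross d p = cross d v /\ cross f p <= cross f v.

Lemma exists_lexmin s d f x0 : x0 \in s -> exists p, lexmin s d f p.
Proof.
elim: s x0 => // x s IH x0 _; case: s IH => [_|y s IH].
  exists x; split => [|v]; first by rewrite inE eqxx.
  by rewrite inE => /eqP ->; right.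
have [|p [ps pP]] := IH y; first by rewrite inE eqxx.
have [h|h] : (cross d x < cross d p \/ cross d x = cross d p /\ cross f x <= cross f p) \/
    (cross d p < cross d x \/ cross d p = cross d x /\ cross f p <= cross f x).
  have [?|?|?] := ltgtP (cross d x) (cross d p); [by left; left|by right; left|].
  by have [?|?] := leP (cross f x) (cross f p); [left; right|right; right; split => //; lra].
  exists x; split => [|v]; rewrite inE ?eqxx// => /predU1P[->|/pP]; first by right.
  by case: h => [h|[h h']] [g|[g g']]; [left|left|left|right; split]; lra.
exists p; split => [|v]; first by rewrite inE ps orbT.
by rewrite inE => /predU1P[->//|/pP].
Qed.

Lemma exists_argmin (T : eqType) (l : seq T) (g : T -> R) (i0 : T) : i0 \in l ->
  exists2 i : T, i \in l & forall j : T, j \in l -> g i <= g j.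
Proof.
elim: l i0 => // x l IH x0 _; case: l IH => [_|y l IH].
  by exists x; [rewrite inE eqxx|move=> y; rewrite inE => /eqP ->].
have [|z zl zP] := IH y; first by rewrite inE eqxx.
have [h|h] := leP (g x) (g z).
  exists x; first by rewrite inE eqxx.
  by move=> v; rewrite inE => /predU1P[->//|/zP]; exact: le_trans.
exists z; first by rewrite inE zl orbT.
by move=> v; rewrite inE => /predU1P[->|/zP//]; exact: ltW.
Qed.

(** An open half-plane with a segment of its boundary line attached: it carries bounds on the
    extremal face from the points of s to their hull. *)
Lemma cvx_lex d f (c lo hi : R) :
  cvx [set x | c < cross d x \/ cross d x = c /\ lo <= cross f x <= hi].
Proof.
move=> x y t /andP[t0 t1]; rewrite /mkset !crossE => Hx Hy.
have [->|tn0] := eqVneq t 0; first by rewrite !mul0r !add0r subr0 !mul1r.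
have [->|tn1] := eqVneq t 1; first by rewrite subrr !mul0r !addr0 !mul1r.
have {tn0}t0 : 0 < t by rewrite lt_neqAle eq_sym tn0.
have {tn1}t1 : 0 < 1 - t by rewrite subr_gt0 lt_neqAle tn1.
have e : t * c + (1 - t) * c = c by ring.
case: Hx Hy => [Hx|[Hx /andP[hx1 hx2]]] [Hy|[Hy /andP[hy1 hy2]]].
- by left; have := ltr_pM2l t0 c (cross d x); have := ltr_pM2l t1 c (cross d y); rewrite Hx Hy; lra.
- by left; have := ltr_pM2l t0 c (cross d x); rewrite Hx Hy; lra.
- by left; have := ltr_pM2l t1 c (cross d y); rewrite Hx Hy; lra.
- right; split; first by rewrite Hx Hy.
  have := ler_pM2l t0 lo (cross f x); have := ler_pM2l t1 lo (cross f y).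
  have := ler_pM2l t0 (cross f x) hi; have := ler_pM2l t1 (cross f y) hi.
  by rewrite hx1 hx2 hy1 hy2; lra.
Qed.

Section PolygonVertices.
Variables (s : seq (R * R)) (pv qv : R * R -> R * R) (o : R * R) (r : R).
Let P := convex_hull [set` s].
Hypotheses (pvP : forall d, lexmin s d (- perp d) (pv d))
           (qvP : forall d, lexmin s d (perp d) (qv d)).
Hypotheses (r0 : 0 < r) (Po : forall u, box o r u -> P u).

(** The face extremal for d as a vector along d, from its first to its last vertex; it is 0 when the
    face is a single vertex. *)
Definition ev d := qv d - pv d.

Let sP v : v \in s -> P v. Proof. by move=> vs; apply: sub_hull. Qed.

Let crossNl d u : cross (- d) u = - cross d u.
Proof. by rewrite /cross !coordE; ring. Qed.

Let perp_d d : cross (perp d) d = - (d.1 ^+ 2 + d.2 ^+ 2).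
Proof. by rewrite cross_antisym cross_perp. Qed.

Let qv_level d : cross d (qv d) = cross d (pv d).
Proof.
have [ps pm] := pvP d; have [qs qm] := qvP d.
by case: (pm _ qs) => [|[-> //]]; case: (qm _ ps) => [|[-> //]]; lra.
Qed.

Lemma evE d : d != 0 -> exists2 k : R, 0 <= k & ev d = k *: d.
Proof.
move=> d0; have [k qE] := same_level d0 (qv_level d).
exists k; last by rewrite /ev qE; vring.
have [ps pm] := pvP d; have [qs qm] := qvP d.
have [|[_]] := pm _ qs; first by rewrite qv_level ltxx.
rewrite qE !crossNl !crossE perp_d => h.
by rewrite -(pmulr_lge0 _ (sqnorm_gt0 d0)); lra.
Qed.

Lemma pv_edge d (k : R) : d != 0 -> 0 <= k -> ev d = k *: d -> edge P d (pv d) k.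
Proof.
move=> d0 k0 kE; have [ps pm] := pvP d; have [qs qm] := qvP d.
have qE : qv d = pv d + k *: d by rewrite -kE /ev addrC subrK.
split => //; [exact: sP|by rewrite -qE; exact: sP| |].
  apply: (hull_sub (@cvx_cross_ge _ d (cross d (pv d)))) => v vs /=.
  by case: (pm v vs) => [/ltW|[->]].
move=> x Px lx; have [t xE] := same_level d0 lx.
have n0 := sqnorm_gt0 d0.
have := hull_sub (@cvx_lex d (- perp d) (cross d (pv d)) (cross (- perp d) (pv d)) (cross
    (- perp d) (qv d))) _ Px.
rewrite /mkset lx ltxx => /(_ _)[|//|[_]].
  move=> v vs; case: (pm v vs) => [|[e1 e2]]; [by left|right].
  split => //; rewrite e2/= !crossNl lerN2.
  by case: (qm v vs) => [|[_ //]]; rewrite qv_level e1 ltxx.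
rewrite xE qE !crossNl !crossE !perp_d => /andP[h1 h2]; exists t => //.
by apply/andP; split; rewrite -(ler_pM2r n0); lra.
Qed.

Lemma pv_scale d (t : R) : d != 0 -> 0 < t -> pv (t *: d) = pv d /\ qv (t *: d) = qv d.
Proof.
move=> d0 t0.
have U g p q : lexmin s d (g *: perp d) p -> lexmin s (t *: d) (g *: perp (t *: d)) q ->
    g != 0 -> p = q.
  move=> [ps pm] [qs qm] g0.
  have Zl e u : cross (t *: e) u = t * cross e u by rewrite /cross !coordE; ring.
  have Gl e u : cross (g *: e) u = g * cross e u by rewrite /cross !coordE; ring.
  have pt : perp (t *: d) = t *: perp d by apply: pairP => //; exact: (esym (mulrN _ _)).
  have := pm _ qs; have := qm _ ps; rewrite pt !Gl !Zl !(ltr_pM2l t0) => h1 h2.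
  have l : cross d p = cross d q.
    by case: h1 h2 => [h1|[/(mulfI (lt0r_neq0 t0)) -> //]] [h2|[-> //]]; lra.
  have [k pE] := same_level d0 l.
  have : g * cross (perp d) p = g * cross (perp d) q.
    have T u v : g * (t * cross (perp d) u) <= g * (t * cross (perp d) v) ->
        g * cross (perp d) u <= g * cross (perp d) v.
      by rewrite !(mulrCA g t) ler_pM2l.
    case: h1 => [|[_ /T h1]]; first by rewrite l ltxx.
    case: h2 => [|[_ h2]]; first by rewrite l ltxx.
    lra.
  move/(mulfI g0); rewrite pE crossD crossZ perp_d => /eqP.
  rewrite -subr_eq0 addrAC subrr add0r mulrN oppr_eq0 mulf_eq0 (gt_eqF (sqnorm_gt0 d0)) orbF.
  by move=> /eqP ->; rewrite scale0r addr0.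
split; apply/esym.
  by apply: (U (-1)); rewrite ?oppr_eq0 ?oner_neq0// scaleN1r; exact: pvP.
by apply: (U 1); rewrite ?oner_neq0// scale1r; exact: qvP.
Qed.

Lemma ev_scale d (t : R) : d != 0 -> 0 < t -> ev (t *: d) = ev d.
Proof. by move=> d0 t0; rewrite /ev; have [-> ->] := pv_scale d0 t0. Qed.

Lemma ev_idem d : d != 0 -> ev d != 0 -> ev (ev d) = ev d.
Proof.
move=> d0 e0; have [k k0 E] := evE d0; rewrite {1}E ev_scale//.
by rewrite lt_neqAle k0 andbT eq_sym; apply: contra_neq e0 => k00; rewrite E k00 scale0r.
Qed.

Let min_in_face d v : d != 0 -> v \in s -> cross d v = cross d (pv d) ->
  exists2 t : R, 0 <= t & pv d = v - t *: d /\ exists2 t' : R, 0 <= t' & qv d = v + t' *: d.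
Proof.
move=> d0 vs lv; have [k k0 E] := evE d0.
have [_ _ _ _ /(_ v (sP vs) lv)[t /andP[t0 tk] vE]] := pv_edge d0 k0 E.
exists t => //; split; first by rewrite vE addrK.
exists (k - t); first by rewrite subr_ge0.
by rewrite -[LHS](subrK (pv d)) -/(ev d) E vE; vring.
Qed.

Let level_min d v : v \in s -> cross d (pv d) <= cross d v.
Proof. by move=> vs; have [_ /(_ v vs)[/ltW|[->]]] := pvP d. Qed.

(* Turning from [a] to [b], the extremal vertex changes only at the direction of an edge. *)
Lemma edge_between a b : 0 < cross a b ->
  (forall y, 0 < cross a y -> 0 < cross y b -> ev y = 0) -> qv a = pv b.
Proof.
move=> ab noedge; have a0 := cross_neq0l (lt0r_neq0 ab).
have b0 : b != 0 by apply: contraTneq ab => ->; rewrite /cross !coordE; lra.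
set q := qv a; set p := pv b.
have qs : q \in s by case: (qvP a).
have ps : p \in s by case: (pvP b).
apply: contrapT => qp.
have last_a v : v \in s -> cross a v = cross a q -> exists2 t : R, 0 <= t & v = q - t *: a.
  move=> vs; rewrite qv_level => lv; have [t t0 [_ [t' t'0 h]]] := min_in_face a0 vs lv.
  by exists t' => //; rewrite /q h addrK.
have first_b v : v \in s -> cross b v = cross b p -> exists2 t : R, 0 <= t & v = p + t *: b.
  move=> vs lv; have [t t0 [h _]] := min_in_face b0 vs lv.
  by exists t => //; rewrite /p h subrK.
have axp : cross a (p - q) > 0.
  rewrite lt_neqAle !crossE subr_ge0 qv_level level_min// andbT eq_sym subr_eq0 -qv_level.
  apply/negP => /eqP /(last_a _ ps)[t t0 pE].
  have t1 : 0 < t by rewrite lt_neqAle t0 andbT eq_sym; apply: contra_not_neq qp => t00;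
      rewrite pE t00 scale0r subr0.
  have := level_min b qs; rewrite -/p pE !crossE (cross_antisym a b) mulrN opprK.
  by rewrite gerDl leNgt mulr_gt0.
have xb : cross (p - q) b > 0.
  rewrite cross_antisym oppr_gt0 lt_neqAle !crossE subr_le0 level_min// andbT subr_eq0 eq_sym.
  apply/negP => /eqP /(first_b _ qs)[t t0 qE].
  move: axp; rewrite qE opprD addrA subrr add0r !crossE ltNge.
  by rewrite oppr_le0 mulr_ge0// ltW.
(* If q and p differed, p would be a point of s in the open cone from q between a and b. The
   quotient minimised next increases with the angle from a, so z is the first point met when turning
   about q. *)
pose l := [seq z <- s | (0 < cross a (z - q)) && (0 < cross (z - q) b)].
have pl : p \in l by rewrite mem_filter axp xb.
have [z] := exists_argmin (fun z => cross a (z - q) / cross (z - q) b) pl.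
rewrite mem_filter => /andP[/andP[az zb] zs] zmin.
set y := z - q in az zb.
have id u : cross y u * cross a b = cross y b * cross a u - cross a y * cross u b.
  by rewrite /cross; ring.
(* No point of s is to the right of the line from q to z, so q and z both lie on the face for y,
   which is then not a single vertex. *)
have left v : v \in s -> 0 <= cross y (v - q).
  move=> vs; rewrite -(pmulr_lge0 _ ab) id.
  have := level_min a vs; rewrite -qv_level le_eqVlt => /predU1P[e|lt].
    have [t t0 vE] := last_a v vs (esym e).
    have -> : v - q = - (t *: a) by rewrite vE; vring.
    have -> : cross a (- (t *: a)) = 0 by rewrite !crossE mulr0 oppr0.
    rewrite mulr0 sub0r (_ : cross _ b = - (t * cross a b)).
      by rewrite mulrN opprK; apply: mulr_ge0; [exact: ltW|apply: mulr_ge0 => //; exact: ltW].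
    by rewrite /cross !coordE; ring.
  have au : 0 < cross a (v - q) by rewrite !crossE subr_gt0.
  have [ub|ub] := leP (cross (v - q) b) 0.
    rewrite subr_ge0 (@le_trans _ _ 0)//; last by rewrite mulr_ge0// ltW.
    by rewrite mulr_ge0_le0// ltW.
  have vl : v \in l by rewrite mem_filter au ub.
  have := zmin v vl; rewrite ler_pdivrMr// mulrAC ler_pdivlMr// -/y => h.
  by rewrite subr_ge0; lra.
have y0 : y != 0 by apply: contraTneq az => ->; rewrite /cross !coordE; lra.
have := noedge y az zb; apply/eqP.
have lq : cross y q = cross y (pv y).
  apply/le_anti; rewrite level_min// andbT.
  by case: (pvP y) => pys _; have := left _ pys; rewrite !crossE subr_ge0.
have lz : cross y z = cross y (pv y).
  by rewrite -lq -[z](subrK q) -/y crossD crossdd add0r.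
have [t t0 [pE [t' t'0 qE]]] := min_in_face y0 qs lq.
have [u u0 [pE' [u' u'0 qE']]] := min_in_face y0 zs lz.
have [k k0 kE] := evE y0.
apply/negP => /eqP e0; move: kE; rewrite e0 => /esym/eqP.
rewrite scaler_eq0 (negbTE y0) orbF => /eqP k00.
have : ev y = (t + t') *: y by rewrite /ev pE qE; vring.
rewrite e0 => /esym/eqP; rewrite scaler_eq0 (negbTE y0) orbF => /eqP tt.
have t00 : t = 0 by lra.
have : ev y = (u + u') *: y by rewrite /ev pE' qE'; vring.
rewrite e0 => /esym/eqP; rewrite scaler_eq0 (negbTE y0) orbF => /eqP uu.
have u00 : u = 0 by lra.
by move/eqP: y0; apply; rewrite /y; move: pE'; rewrite pE t00 u00 !scale0r !subr0 => ->;
    rewrite subrr.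
Qed.

End PolygonVertices.
End Vertices.

(** * Opposite edges and diagonals of the polygon *)

Section Edges.
Context {R : realType}.
Implicit Types (u v w x y z a b c d f p q o : R * R) (s : seq (R * R)).
Variables (s : seq (R * R)) (pv qv : R * R -> R * R) (o : R * R) (r : R).
Let P := convex_hull [set` s].
Hypotheses (pvP : forall d, lexmin s d (- perp d) (pv d))
           (qvP : forall d, lexmin s d (perp d) (qv d)).
Hypotheses (r0 : 0 < r) (Po : forall u, box o r u -> P u).
Local Notation ev := (ev pv qv).
Hypothesis ev_opp : forall d, d != 0 -> ev (- d) = - ev d.

(** A half-plane with half of its boundary line, selecting one vector from each opposite pair. *)
Definition upper x := (0 < x.1) || ((x.1 == 0) && (0 < x.2)).

Let leC a b := 0 <= cross a b.

Lemma upper_neq0 x : upper x -> x != 0.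
Proof. by apply: contraTneq => ->; rewrite /upper !coordE eqxx ltxx. Qed.

Lemma upperVopp x : x != 0 -> upper x \/ upper (- x).
Proof.
move=> x0; rewrite /upper !coordE oppr_eq0 !oppr_gt0.
have [h|h|h] := ltgtP 0 x.1; [by left|by right|].
rewrite ?(esym h) ?eqxx ?ltxx /=; have [h'|h'|h'] := ltgtP 0 x.2; [by left|by right|].
by move: x0; rewrite (_ : x = 0) ?eqxx//; apply: pairP.
Qed.

Lemma upper_scale x (t : R) : 0 < t -> upper (t *: x) = upper x.
Proof. by move=> t0; rewrite /upper !coordE !pmulr_rgt0// mulf_eq0 gt_eqF. Qed.

Lemma upper_scale_gt0 x (t : R) : upper x -> upper (t *: x) -> 0 < t.
Proof.
rewrite /upper !coordE => /orP[h|/andP[/eqP h h']] /orP[g|/andP[/eqP g g']].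
- by rewrite pmulr_lgt0 in g.
- move/eqP: g; rewrite mulf_eq0 => /orP[/eqP t0|/eqP e]; last by rewrite e ltxx in h.
  by rewrite t0 mul0r ltxx in g'.
- by rewrite h mulr0 ltxx in g.
- by rewrite pmulr_lgt0 in g'.
Qed.

Lemma upper_between a b y : upper a -> upper b -> 0 < cross a y -> 0 < cross y b ->
  0 < cross a b -> upper y.
Proof.
move=> ua ub ay yb ab; have ab0 := lt0r_neq0 ab.
rewrite (cross_basis y ab0); set al := _ / _; set be := _ / _.
have al0 : 0 < al by exact: divr_gt0.
have be0 : 0 < be by exact: divr_gt0.
move: ua ub; rewrite -(upper_scale a al0) -(upper_scale b be0) /upper !coordE.
move: (al * a.1) (al * a.2) (be * b.1) (be * b.2) => a1 a2 b1 b2.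
move=> /orP[h|/andP[/eqP h h']] /orP[g|/andP[/eqP g g']]; apply/orP; [left|left|left|right]; lra.
Qed.

Lemma leC_trans : {in upper & &, transitive leC}.
Proof.
move=> b a c ub ua uc; rewrite /leC => ab bc.
have id : b.1 * cross a c = a.1 * cross b c + c.1 * cross a b by rewrite /cross; ring.
have ge1 x : upper x -> 0 <= x.1 by case/orP => [/ltW//|/andP[/eqP -> _]].
have [b1|b1] := ltP 0 b.1.
  rewrite -(pmulr_rge0 _ b1) id addr_ge0// mulr_ge0// ge1//.
have {}b1 : b.1 = 0 by apply/le_anti; rewrite b1 ge1.
have b2 : 0 < b.2 by move: ub; rewrite -topredE /= /upper b1 ltxx eqxx.
have c1 : c.1 = 0.
  apply/le_anti; rewrite ge1// andbT; move: bc; rewrite /cross b1 mul0r sub0r oppr_ge0.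
  by rewrite pmulr_rle0.
rewrite /cross c1 mulr0 subr0 mulr_ge0 ?ge1//.
by move: uc; rewrite -topredE /= /upper c1 ltxx eqxx => /ltW.
Qed.

(** By [ev_idem] the edge vectors are the non-zero fixed points of [ev]; they are sorted by
    angle. *)
Definition edges := sort leC
  [seq x <- undup [seq v - u | v <- s, u <- s] | upper x && (ev x == x)].

Lemma mem_edges x : (x \in edges) = upper x && (ev x == x).
Proof.
rewrite mem_sort mem_filter mem_undup; apply: andb_idr => /andP[_ /eqP ex].
rewrite -ex; apply: allpairs_f; first by case: (qvP x).
by case: (pvP x).
Qed.

Let m := size edges.
Let e k := nth 0 edges k.

Let eP k : (k < m)%N -> upper (e k) /\ ev (e k) = e k.
Proof. by move=> km; have := mem_nth 0 km; rewrite mem_edges => /andP[? /eqP]. Qed.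

Let e_neq0 k : (k < m)%N -> e k != 0.
Proof. by case/eP => /upper_neq0. Qed.

(** Two parallel edges of the list would be positive multiples of each other, hence equal because
    [ev] ignores positive scaling. *)
Lemma edges_cross k l : (k < l < m)%N -> 0 < cross (e k) (e l).
Proof.
move=> /andP[kl lm]; have km := ltn_trans kl lm.
have ue : {in edges, forall x, upper x} by move=> x; rewrite mem_edges => /andP[].
have pw : pairwise leC edges.
  rewrite -(@sorted_pairwise_in _ upper).
  - by apply: sort_sorted => a b; rewrite /leC (cross_antisym a b) oppr_ge0 le_total.
  - exact: leC_trans.
  - by apply/allP => x /ue.
have := pairwiseP 0 pw; move/(_ k l km lm kl); rewrite /leC -/(e k) -/(e l) le_eqVlt.
move=> /predU1P[c0|//].
have [uk ek] := eP km; have [ul el] := eP lm.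
have c0' : cross (e k) (e l) = cross (e k) 0 by rewrite -c0 /cross !coordE; ring.
have [t elE] := same_level (e_neq0 km) c0'; rewrite add0r in elE.
have t0 : 0 < t by apply: (upper_scale_gt0 uk); rewrite -elE.
have : e l = e k by rewrite -el elE (ev_scale pvP qvP)// e_neq0.
move/eqP; rewrite nth_uniq ?sort_uniq ?filter_uniq ?undup_uniq//.
by move=> /eqP lk; rewrite lk ltnn in kl.
Qed.

Let e_cross_le k l : (k < m)%N -> (l < m)%N -> 0 < cross (e k) (e l) -> (k < l)%N.
Proof.
move=> km lm kl; rewrite ltnNge leq_eqVlt; apply/negP => /predU1P[lk|lk].
  by rewrite lk crossdd ltxx in kl.
by have := @edges_cross l k; rewrite lk km => /(_ isT); rewrite cross_antisym; lra.
Qed.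

Let ev_index y : y != 0 -> ev y != 0 ->
    exists k (t : R), [/\ (k < m)%N, t != 0, y = t *: e k & upper y -> 0 < t].
Proof.
move=> y0 ey0; have [t t0 E] := evE pvP qvP y0.
have {}t0 : 0 < t by rewrite lt_neqAle t0 andbT eq_sym; apply: contra_neq ey0 => t00;
    rewrite E t00 scale0r.
have ei := ev_idem pvP qvP y0 ey0.
have yE : y = t^-1 *: ev y by rewrite E scalerA mulVf ?scale1r// gt_eqF.
have [u|u] := upperVopp ey0.
  have : ev y \in edges by rewrite mem_edges u ei eqxx.
  move/(nthP 0) => [k km kE]; exists k, t^-1; split => //; rewrite ?invr_neq0 ?gt_eqF ?invr_gt0//.
  by rewrite /e kE.
have : - ev y \in edges by rewrite mem_edges u ev_opp// ei eqxx.
move/(nthP 0) => [k km kE]; exists k, (- t^-1); split => //; rewrite ?oppr_eq0 ?invr_neq0 ?gt_eqF//.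
  by rewrite /e kE scalerN scaleNr opprK.
move=> uy; have : upper (ev y) by rewrite E upper_scale.
move=> u'; have := upper_scale_gt0 u' (t := -1); rewrite scaleN1r => /(_ u).
by rewrite ltr0N1.
Qed.

Definition no_edge a b := forall y, 0 < cross a y -> 0 < cross y b -> ev y = 0.

Let crossNN a b : cross (- a) (- b) = cross a b.
Proof. by rewrite /cross !coordE; ring. Qed.

Let no_edgeN a b : no_edge a b -> no_edge (- a) (- b).
Proof.
move=> ab y; rewrite -{1 2}[y](opprK) !crossNN => ay yb.
have yn : - y != 0 by apply: contraTneq ay => ->; rewrite /cross !coordE; lra.
by rewrite -[y]opprK ev_opp// ab// oppr0.
Qed.

Let between_neq0 a y : 0 < cross a y -> y != 0.
Proof. by move=> ay; apply: contraTneq ay => ->; rewrite /cross !coordE; lra. Qed.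

Let no_edge_succ k : (k.+1 < m)%N -> no_edge (e k) (e k.+1).
Proof.
move=> km y ay yb; apply: contrapT => /eqP ey0.
have [u1 _] := eP (ltnW km); have [u2 _] := eP km.
have uy : upper y by apply: (upper_between u1 u2 ay yb); apply: edges_cross; rewrite ltnSn.
have [l [t [lm tn yE /(_ uy) t0]]] := ev_index (between_neq0 ay) ey0.
have h1 : (k < l)%N by apply: e_cross_le => //; [exact: ltnW|move: ay;
    rewrite yE !crossE pmulr_rgt0].
have : (l < k.+1)%N.
  apply: e_cross_le => //; move: yb; rewrite yE (_ : cross _ _ = t * cross (e l) (e k.+1)).
    by rewrite pmulr_rgt0.
  by rewrite /cross !coordE; ring.
by rewrite ltnS leqNgt h1.
Qed.

Let no_edge_last : (0 < m)%N -> no_edge (e m.-1) (- e 0).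
Proof.
move=> m0 y ay yb; apply: contrapT => /eqP ey0.
have m1 : (m.-1 < m)%N by rewrite prednK.
have [l [t [lm tn yE _]]] := ev_index (between_neq0 ay) ey0.
have [t0|t0] := ltP 0 t.
  have : (m.-1 < l)%N by apply: e_cross_le => //; move: ay; rewrite yE !crossE pmulr_rgt0.
  by rewrite ltnNge -ltnS prednK// lm.
have {}t0 : t < 0 by rewrite lt_neqAle tn.
suff : (l < 0)%N by [].
apply: e_cross_le => //; move: yb; rewrite yE (_ : cross _ _ = - t * cross (e l) (e 0)).
  by rewrite pmulr_rgt0// oppr_gt0.
by rewrite /cross !coordE; ring.
Qed.

Let qvE d : qv d = pv d + ev d.
Proof. exact: (esym (subrKC _ _)). Qed.


Let level_lt d : d != 0 -> cross d (pv d) < cross d (pv (- d)).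
Proof.
move=> d0; have [k k0 kE] := evE pvP qvP d0.
have dn : - d != 0 by rewrite oppr_eq0.
have [l l0 lE] := evE pvP qvP dn.
have E1 := pv_edge pvP qvP d0 k0 kE.
have E2 := pv_edge pvP qvP dn l0 lE.
have := edge_levels r0 Po d0 E1 (p' := pv (- d) - l *: d) (k' := l).
rewrite subrK => /(_ E2) /andP[h1 h2]; apply: lt_trans h1 _.
by move: h2; rewrite !crossE mulr0 subr0.
Qed.

Let edge_turn a b : 0 < cross a b -> no_edge a b -> pv b = pv a + ev a.
Proof. by move=> ab ne; rewrite -qvE (edge_between pvP qvP ab ne). Qed.

(** If all edges were parallel to x, turning from x through [perp x] to - x would move the extremal
    vertex only along x, leaving [pv x] and [pv (- x)] at the same level, against the interior
    point. *)
Let two_edges : (1 < m)%N.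
Proof.
rewrite ltnNge; apply/negP => m1.
have [x [x0 xP]] : exists x, x != 0 /\ forall y, y != 0 -> ev y != 0 -> cross x y = 0.
  have [m0|m0] := posnP m.
    exists (1, 0); split; first by apply/eqP => -[/eqP]; rewrite oner_eq0.
    by move=> y y0 ey; have [k [t [+ _ _ _]]] := ev_index y0 ey; rewrite m0.
  exists (e 0); split; first exact: e_neq0.
  move=> y y0 ey; have [k [t [km _ -> _]]] := ev_index y0 ey.
  have -> : k = 0%N by apply/eqP; rewrite -leqn0 -ltnS (leq_trans km).
  by rewrite !crossE mulr0.
have xb : 0 < cross x (perp x) by rewrite cross_perp sqnorm_gt0.
have bx : 0 < cross (perp x) (- x) by rewrite !crossE -cross_antisym.
have pE : pv (perp x) = pv x + ev x.
  apply: edge_turn => // y xy _; apply: contrapT => /eqP ey.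
  by have y0 := between_neq0 xy; move: xy; rewrite xP// ltxx.
have qE : pv (- x) = pv (perp x) + ev (perp x).
  apply: edge_turn => // y _ yx; apply: contrapT => /eqP ey.
  have y0 : y != 0 by apply: contraTneq yx => ->; rewrite /cross !coordE; lra.
  by move: yx; rewrite crossN cross_antisym opprK xP// ltxx.
have b0 : perp x != 0 by exact: between_neq0 xb.
have eb : ev (perp x) = 0.
  by apply: contrapT => /eqP /(xP _ b0) c0; rewrite c0 ltxx in xb.
have := level_lt x0; rewrite qE eb addr0 pE crossD.
by have [k _ ->] := evE pvP qvP x0; rewrite !crossE mulr0 addr0 ltxx.
Qed.

Let m_gt0 : (0 < m)%N. Proof. exact: ltnW. Qed.

Let cross_last : 0 < cross (e m.-1) (- e 0).
Proof.
rewrite crossN -cross_antisym; apply: edges_cross.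
by rewrite ltn_predL m_gt0 andbT -ltnS prednK.
Qed.

Let pv_succ k : (k.+1 < m)%N -> pv (e k.+1) = pv (e k) + e k.
Proof.
move=> km; rewrite -[X in _ + X](eP (ltnW km)).2.
by apply: edge_turn; [apply: edges_cross; rewrite ltnSn|exact: no_edge_succ].
Qed.

Let ev_opp_e k : (k < m)%N -> ev (- e k) = - e k.
Proof. by move=> km; rewrite ev_opp ?e_neq0//; have [_ ->] := eP km. Qed.

Let pvN_succ k : (k.+1 < m)%N -> pv (- e k.+1) = pv (- e k) - e k.
Proof.
move=> km; rewrite -[X in _ + X](ev_opp_e (ltnW km)); apply: edge_turn.
  by rewrite crossNN; apply: edges_cross; rewrite ltnSn.
by apply: no_edgeN; exact: no_edge_succ.
Qed.

Let pvN_first : pv (- e 0) = pv (e m.-1) + e m.-1.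
Proof.
have m1 : (m.-1 < m)%N by rewrite prednK.
rewrite -[X in _ + X](eP m1).2.
by apply: edge_turn; [exact: cross_last|exact: no_edge_last].
Qed.

Let pv_first : pv (e 0) = pv (- e m.-1) - e m.-1.
Proof.
have m1 : (m.-1 < m)%N by rewrite prednK.
rewrite -[X in _ + X](ev_opp_e m1) -{1}[e 0]opprK; apply: edge_turn.
  by rewrite crossNN; exact: cross_last.
by apply: no_edgeN; exact: no_edge_last.
Qed.

(** From the first vertex of the k-th edge to the first vertex of its opposite. At index m the half
    turn is complete and the edge - e 0 comes next, which exchanges the two ends. *)
Definition diagonal k := if (k < m)%N then pv (- e k) - pv (e k) else pv (e 0) - pv (- e 0).

Lemma diagonal_succ k : (k < m)%N -> diagonal k.+1 = diagonal k - 2 *: e k.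
Proof.
move=> km; rewrite /diagonal km; case: ltnP => h; first by rewrite pv_succ// pvN_succ//; vring.
have -> : k = m.-1 by apply/eqP; rewrite eqn_leq -ltnS prednK// km /= -ltnS prednK.
by rewrite pv_first pvN_first; vring.
Qed.

Lemma diagonal_last : diagonal m = - diagonal 0.
Proof. by rewrite /diagonal ltnn m_gt0 opprB. Qed.

Lemma edge_diagonal k : (k < m)%N -> e k = 2^-1 *: (diagonal k - diagonal k.+1).
Proof. by move=> km; rewrite diagonal_succ//; apply: pairP; rewrite !coordE; field. Qed.

Let tau k := 2^-1 *: (diagonal k + diagonal k.+1).

Let tauE k : (k < m)%N -> tau k = diagonal k - e k.
Proof. by move=> km; rewrite /tau diagonal_succ//; apply: pairP; rewrite !coordE; field. Qed.

Lemma edge_pair k : (k < m)%N -> [/\ e k != 0, edge P (e k) (pv (e k)) 1 &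
  edge P (- e k) (pv (e k) + tau k + 1 *: e k) 1].
Proof.
move=> km; have ek := e_neq0 km; split => //.
  by apply: pv_edge => //; have [_ ->] := eP km; rewrite scale1r.
rewrite (_ : _ + _ + _ = pv (- e k)); last by rewrite tauE// /diagonal km; vring.
by apply: pv_edge; rewrite ?oppr_eq0// ev_opp_e// scale1r.
Qed.

Let sum_edges i j : R * R := \sum_(i <= k < j) e k.

Let diagonal_sum k : (k <= m)%N -> diagonal k = diagonal 0 - 2 *: sum_edges 0 k.
Proof.
elim: k => [_|k IH km]; first by rewrite /sum_edges big_geq// scaler0 subr0.
rewrite diagonal_succ// IH ?(ltnW km)// /sum_edges big_nat_recr//=; vring.
Qed.

Let diagonal0 : diagonal 0 = sum_edges 0 m.
Proof.
have := diagonal_sum (leqnn m); rewrite diagonal_last => /eqP.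
rewrite -subr_eq0 => /eqP h; apply/eqP; rewrite -subr_eq0; apply/eqP.
have : -2^-1 *: (- diagonal 0 - (diagonal 0 - 2 *: sum_edges 0 m)) = 0 by rewrite h scaler0.
by move=> <-; apply: pairP; rewrite !coordE; field.
Qed.

Let cross_sums i j i' j' : (j <= i')%N -> (j' <= m)%N ->
    0 <= cross (sum_edges i j) (sum_edges i' j').
Proof.
move=> ji jm; rewrite /sum_edges !big_nat.
apply: (big_ind (fun u => 0 <= cross u _)) => [|u v hu hv|k /andP[ik kj]].
- by rewrite (_ : cross 0 _ = 0)// /cross !coordE; ring.
- have -> w : cross (u + v) w = cross u w + cross v w by rewrite /cross !coordE; ring.
  exact: addr_ge0.
apply: (big_ind (fun u => 0 <= cross _ u)) => [|u v hu hv|l /andP[il lj]].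
- by rewrite (_ : cross _ 0 = 0)// /cross !coordE; ring.
- by rewrite crossD addr_ge0.
by apply/ltW/edges_cross; rewrite (leq_trans kj (leq_trans ji il)) (leq_trans lj jm).
Qed.

(* Both vectors are signed sums of the edges; expanding, every term has the same sign. *)
Lemma tau_cross k l : (k < l < m)%N -> 0 < cross (tau k) (tau l).
Proof.
move=> /andP[kl lm]; have km := ltn_trans kl lm.
pose A := sum_edges 0 k; pose X := sum_edges k.+1 l; pose Y := sum_edges l.+1 m.
have s1 k' : (k' < m)%N -> sum_edges 0 k'.+1 = sum_edges 0 k' + e k'.
  by move=> _; rewrite /sum_edges big_nat_recr.
have sl : sum_edges 0 l = A + e k + X.
  by rewrite /A /X -s1// /sum_edges -big_cat_nat.
have sm : sum_edges 0 m = A + e k + X + e l + Y.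
  by rewrite -sl -s1// /Y /sum_edges -big_cat_nat.
have tk : tau k = X + e l + Y - A.
  by rewrite tauE// diagonal_sum ?(ltnW km)// diagonal0 sm -/A; vring.
have tl : tau l = Y - A - e k - X.
  by rewrite tauE// diagonal_sum ?(ltnW lm)// diagonal0 sm sl; vring.
have se i : sum_edges i i.+1 = e i by rewrite /sum_edges big_nat1.
have AX : 0 <= cross A X by apply: cross_sums => //; exact: ltnW.
have XY : 0 <= cross X Y by apply: cross_sums.
have kX : 0 <= cross (e k) X by rewrite -se; apply: cross_sums => //; exact: ltnW.
have Xl : 0 <= cross X (e l) by rewrite -se; apply: cross_sums.
have lY : 0 <= cross (e l) Y by rewrite -se; apply: cross_sums.
have Al : 0 <= cross A (e l) by rewrite -se; apply: cross_sums => //; exact: ltnW.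
have kY : 0 <= cross (e k) Y by rewrite -[e k]se; apply: cross_sums => //; exact: ltnW.
have Ak : 0 <= cross A (e k) by rewrite -[e k]se; apply: cross_sums.
have kl0 : 0 < cross (e k) (e l) by apply: edges_cross; rewrite kl.
rewrite tk tl.
rewrite (_ : cross _ _ = 2 * (cross X Y + cross A X) + cross (e k) X + cross (e k) (e l) +
   (cross (e l) Y + cross A (e l)) + cross X (e l) + (cross (e k) Y + cross A (e k))).
  lra.
by rewrite /cross !coordE; ring.
Qed.

(** With two pairs the vertices are a, a + u, a + u + v and a + v, and the four extremality
    inequalities say that both coordinates of x - a in the basis u, v lie in [0, 1]. *)
Lemma three_edges : ~ parallelogram P -> (2 < m)%N.
Proof.
move=> np; rewrite ltn_neqAle two_edges andbT; apply/eqP => m2; apply: np.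
have cP : cvx P by exact: hull_cvx.
have vP d : P (pv d) by apply: sub_hull; case: (pvP d).
set u := e 0; set v := e 1; set a := pv u.
have uv : 0 < cross u v by apply: edges_cross; rewrite -m2.
have m1 : m.-1 = 1%N by rewrite -m2.
have e1 : pv v = a + u by apply: pv_succ; rewrite -m2.
have e2 : pv (- u) = a + u + v by rewrite /u pvN_first m1 -/v e1.
have e3 : pv (- v) = a + v.
  by rewrite /v pvN_succ -?m2// -/u e2; vring.
have low d x : d != 0 -> P x -> cross d (pv d) <= cross d x.
  move=> d0; have [k k0 kE] := evE pvP qvP d0.
  by have [_ _ _ + _] := pv_edge pvP qvP d0 k0 kE; apply.
have u0 : u != 0 by exact: e_neq0.
have v0 : v != 0 by apply: e_neq0; rewrite -m2.
exists a, u, v; split.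
  by move: uv; rewrite /cross subr_gt0 => /gt_eqF ->.
apply/seteqP; split => x.
  move=> Px; have h1 := low u x u0 Px; have h2 := low v x v0 Px.
  have h3 := low (- u) x _ Px; have h4 := low (- v) x _ Px.
  rewrite !oppr_eq0 e2 in h3; rewrite !oppr_eq0 e3 in h4.
  move: h1 (h2) (h3 u0) (h4 v0); rewrite -/a e1 => {}h1 {}h2 {}h3 {}h4.
  have l2 : 0 <= cross (x - a) v <= cross u v.
    by move: h2 h4; rewrite /cross !coordE; lra.
  have l1 : 0 <= cross u (x - a) <= cross u v.
    by move: h1 h3; rewrite /cross !coordE; lra.
  have F (g : R) : 0 <= g <= cross u v -> 0 <= g / cross u v <= 1.
    by move=> /andP[c0 c1]; rewrite divr_ge0 ?(ltW uv)//= ler_pdivrMr// mul1r.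
  exists (cross (x - a) v / cross u v); first by rewrite /= in_itv; exact: F.
  exists (cross u (x - a) / cross u v); first by rewrite /= in_itv; exact: F.
  by rewrite -addrA -cross_basis ?gt_eqF// addrC subrK.
move=> [s' /=]; rewrite in_itv /= => s01 [t' /=]; rewrite in_itv /= => t01 <-.
have Pa : P a by exact: vP.
have Pb : P (a + u) by rewrite -e1; exact: vP.
have Pc : P (a + v) by rewrite -e3; exact: vP.
have Pd : P (a + u + v) by rewrite -e2; exact: vP.
rewrite (_ : _ + _ = t' *: (s' *: (a + u + v) + (1 - s') *: (a + v)) + (1 - t') *: (s' *:
    (a + u) + (1 - s') *: a)).
  by apply: (cP) => //; apply: (cP).
vring.
Qed.

End Edges.

(** * Lattices *)

Section Lattice.
Context {R : realType}.
Implicit Types (u v w x y z a b c d f p q o : R * R).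

Definition lattice_map a b (ij : int * int) : R * R :=
  ij.1%:~R *: a + ij.2%:~R *: b.

Lemma lattice_map_is_zmod_morphism a b : zmod_morphism (lattice_map a b).
Proof. by move=> [i j] [k l]; rewrite /lattice_map /= !intrB; vring. Qed.

HB.instance Definition _ a b :=
  GRing.isZmodMorphism.Build (int * int)%type (R * R)%type (lattice_map a b)
    (lattice_map_is_zmod_morphism a b).

Lemma lattice_map_coord a b ij : cross a b != 0 ->
  ij.1%:~R = cross (lattice_map a b ij) b / cross a b /\
  ij.2%:~R = cross a (lattice_map a b ij) / cross a b.
Proof. by rewrite /lattice_map /cross !coordE => ab; split; field. Qed.

Lemma lattice_map_inj a b : cross a b != 0 -> injective (lattice_map a b).
Proof.
move=> ab [i j] [k l] e; have [/= h1 h2] := lattice_map_coord (i, j) ab.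
have [/= h3 h4] := lattice_map_coord (k, l) ab; rewrite e -h3 in h1; rewrite e -h4 in h2.
by congr (_, _); apply: (@intr_inj R).
Qed.

Lemma int_small (i : int) (t : R) : 0 < t -> `|i%:~R| * t < t -> i = 0.
Proof.
move=> t0; rewrite -{2}[t]mul1r ltr_pM2r// => h; apply/eqP; apply: contraTT h => i0.
by rewrite -leNgt -intr_norm ler1z -gtz0_ge1 normr_gt0.
Qed.

Lemma lattice_range a b : cross a b != 0 -> lattice (range (lattice_map a b)).
Proof.
move=> ab; split; last by exists (lattice_map a b); split => //; exact: lattice_map_inj.
- split; first by apply/mem_set; exists 0 => //; exact: raddf0.
  move=> _ _ /set_mem[i _ <-] /set_mem[j _ <-]; apply/mem_set.
  by exists (i - j) => //; exact: raddfB.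
- move=> _ [ij _ <-]; split; first by apply/mem_set; exists ij.
  (* In a box of radius D / N the values of [cross a] and [cross b] vary by less than D, whereas on
     the lattice they change by integral multiples of [cross a b]. *)
  pose D := `|cross a b|; have D0 : 0 < D by rewrite normr_gt0.
  pose N := `|a.1| + `|a.2| + (`|b.1| + `|b.2|) + 1.
  have Na : `|a.1| + `|a.2| < N by rewrite /N; have := normr_ge0 b.1; have := normr_ge0 b.2; lra.
  have Nb : `|b.1| + `|b.2| < N by rewrite /N; have := normr_ge0 a.1; have := normr_ge0 a.2; lra.
  have N0 : 0 < N by apply: le_lt_trans Na; rewrite addr_ge0.
  exists [set` box (lattice_map a b ij) (D / N)].
    by apply/nbhs_boxP; exists (D / N) => //; rewrite divr_gt0.
  apply/seteqP; split; last first.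
    move=> _ ->; split; last by exists ij.
    by apply: box_center; rewrite ltW// divr_gt0.
  move=> y [bx [kl _ yE]]; rewrite -yE in bx *; congr lattice_map.
  have small f : `|f.1| + `|f.2| < N ->
      `|cross f (lattice_map a b kl) - cross f (lattice_map a b ij)| < D.
    move=> fN; apply: le_lt_trans (cross_box f bx) _.
    by rewrite mulrCA gtr_pMr// ltr_pdivrMr// mul1r.
  have E1 : kl.2 = ij.2.
    apply/eqP; rewrite -subr_eq0; apply/eqP; apply: (int_small D0); have := small a Na.
    rewrite (_ : _ - _ = (kl.2 - ij.2)%:~R * cross a b) ?normrM//.
    by rewrite /lattice_map /cross !coordE /= intrB; ring.
  have E2 : kl.1 = ij.1.
    apply/eqP; rewrite -subr_eq0; apply/eqP; apply: (int_small D0); have := small b Nb.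
    rewrite (_ : _ - _ = - ((kl.1 - ij.1)%:~R * cross a b)) ?normrN ?normrM//.
    by rewrite /lattice_map /cross !coordE /= intrB; ring.
  by rewrite [LHS]surjective_pairing [RHS]surjective_pairing E1 E2.
Qed.

Variables (L : R * R -> nat) (r0 : R) (K0 : nat).
Hypotheses (r0_gt0 : 0 < r0) (Lb : box_bound L r0 K0).

Lemma lattice_mult a b : cross a b != 0 ->
  (forall x, L (x + a) = L x) -> (forall x, L (x + b) = L x) ->
  translation_invariant L (range (lattice_map a b)) /\
  finite_union_of_translates L (range (lattice_map a b)).
Proof.
move=> ab La Lb'.
have inv : translation_invariant L (range (lattice_map a b)).
  move=> _ x [[i j] _ <-]; apply/eqP; rewrite -eqz_nat; apply/eqP.
  rewrite /lattice_map addrA.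
  pose F y := (L y)%:Z; rewrite -/(F _) -/(F x).
  by rewrite (@periodMz _ F b) ?(@periodMz _ F a)// => y; rewrite /F ?La ?Lb'.
split => //.
(* The half-open fundamental parallelogram has exactly one point in each coset, so the points of
   Lambda in it, repeated by multiplicity, are the required translates. *)
pose D := [set x : R * R | exists s t : R, [/\ 0 <= s < 1, 0 <= t < 1 & x = s *: a + t *: b]].
have bD : bdd D.
  exists (`|a.1| + `|a.2| + (`|b.1| + `|b.2|)) => _ [s [t [/andP[s0 s1] /andP[t0 t1] ->]]].
  have h (g q : R) : 0 <= g -> g < 1 -> `|g * q| <= `|q|.
    by move=> g0 g1; rewrite normrM ler_piMl// ger0_norm// ltW.
  have := h s a.1 s0 s1; have := h s a.2 s0 s1; have := h t b.1 t0 t1; have := h t b.2 t0 t1.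
  rewrite /box !coordE !subr0 => h1 h2 h3 h4.
  by apply/andP; split; apply: le_trans (ler_normD _ _) _;
    have := normr_ge0 a.1; have := normr_ge0 a.2; have := normr_ge0 b.1; have := normr_ge0 b.2; lra.
have [l [ul lP]] := cover_list r0_gt0 Lb bD.
pose l' := [seq t <- l | t \in D].
exists (flatten [seq nseq (L t) t | t <- l']) => x.
rewrite count_flatten sumnE big_map big_map.
under eq_bigr => t _ do rewrite count_nseq.
pose t0 := x - lattice_map a b (Num.floor (cross x b / cross a b), Num.floor
    (cross a x / cross a b)).
have fr (g : R) : 0 <= g - (Num.floor g)%:~R < 1.
  by have := floor_itv g; rewrite intrD1; lra.
have Dt0 : D t0.
  exists (cross x b / cross a b - (Num.floor (cross x b / cross a b))%:~R).
  exists (cross a x / cross a b - (Num.floor (cross a x / cross a b))%:~R).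
  split => //; rewrite /t0 {1}(cross_basis x ab) /lattice_map /=; vring.
have xt0 : x - t0 \in range (lattice_map a b).
  by apply/mem_set; rewrite /t0 subKr; eexists.
have uniq0 t : t \in l' -> x - t \in range (lattice_map a b) -> t = t0.
  rewrite mem_filter => /andP[/set_mem[s1 [s2 [h1 h2 tE]]] _] /set_mem[[i j] _ xt].
  move: Dt0 => [q1 [q2 [g1 g2 t0E]]].
  move: xt0 => /set_mem[[i' j'] _ xt'].
  have e : (s1 - q1) *: a + (s2 - q2) *: b = lattice_map a b (i' - i, j' - j).
    transitivity (t - t0); first by rewrite tE t0E; vring.
    transitivity (lattice_map a b (i', j') - lattice_map a b (i, j));
        first by rewrite xt xt'; vring.
    by rewrite -raddfB.
  have [/= e1 e2] := lattice_map_coord (i' - i, j' - j) ab.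
  rewrite -e (_ : cross (_ + _) b = (s1 - q1) * cross a b) ?mulfK// in e1;
      last by rewrite /cross !coordE; ring.
  rewrite -e (_ : cross a (_ + _) = (s2 - q2) * cross a b) ?mulfK// in e2;
      last by rewrite /cross !coordE; ring.
  have z1 : i' - i = 0 by apply: (int_small ltr01); rewrite mulr1 e1 ltr_norml; lra.
  have z2 : j' - j = 0 by apply: (int_small ltr01); rewrite mulr1 e2 ltr_norml; lra.
  move: e1 e2; rewrite z1 z2 => e1 e2.
  by rewrite tE t0E; congr (_ *: _ + _ *: _); lra.
have Lt0 : L t0 = L x by rewrite -[in RHS](subrK t0 x) addrC; apply/esym/inv/set_mem.
have [L0|Ln] := eqVneq (L t0) 0%N.
  rewrite -Lt0 L0 big_seq big1// => t tl.
  have [xt|] := boolP (x - t \in _); last by rewrite mul0n.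
  by rewrite (uniq0 t tl xt) L0 muln0.
have t0l : t0 \in l' by rewrite mem_filter lP// andbT; exact: mem_set.
rewrite (bigD1_seq t0) ?filter_uniq//= xt0 mul1n Lt0 big_seq_cond big1 ?addn0// => t /andP[tl tt].
have [xt|] := boolP (x - t \in _); last by rewrite mul0n.
by rewrite (uniq0 t tl xt) eqxx in tt.
Qed.

End Lattice.

(** * Tilings *)

Section Tiling.
Context {R : realType}.
Implicit Types (u v w x y z a b c d f p q o : R * R) (P : set (R * R)).

(** A box has positive measure and so is not contained in a null set. *)
Lemma ae_dense (Q : R * R -> Prop) a (h : R) : 0 < h ->
  {ae ((@lebesgue_measure R) \x (@lebesgue_measure R))%E, forall x, Q x} ->
  exists2 x, box a h x & Q x.
Proof.
move=> h0 [N [mN N0 QN]]; apply: contrapT => nex.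
pose I1 := `[a.1 - h, a.1 + h]%classic; pose I2 := `[a.2 - h, a.2 + h]%classic.
have sub : I1 `*` I2 `<=` N.
  move=> x [/= x1 x2]; apply: QN => /= Qx; apply: nex; exists x => //.
  move: x1 x2; rewrite /I1 /I2 /= !in_itv /= => x1 x2; apply/andP; rewrite !ler_norml.
  by split; lra.
have m12 : measurable (I1 `*` I2) by apply: measurableX; exact: measurable_itv.
have : (((@lebesgue_measure R) \x (@lebesgue_measure R)) (I1 `*` I2) <=
        ((@lebesgue_measure R) \x (@lebesgue_measure R)) N)%E.
  by apply: le_measure => //; exact: mem_set.
rewrite N0 product_measure1E; [|exact: measurable_itv|exact: measurable_itv].
have I2h g : @lebesgue_measure R `[g - h, g + h]%classic = (h + h)%:E.
  rewrite lebesgue_measure_itv /= lte_fin ifT; last by lra.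
  by rewrite -EFinB; congr EFin; ring.
move=> H; have {H} : (@lebesgue_measure R I1 * @lebesgue_measure R I2 <= 0)%E := H.
by rewrite /I1 /I2 !I2h -EFinM lee_fin; nra.
Qed.

Variables (P : set (R * R)) (L : R * R -> nat).

Lemma esum_mult x : bdd P -> forall l, uniq l ->
  (forall y, P (x - y) -> L y != 0%N -> y \in l) ->
  \esum_(y in mset_support L) ((L y)%:R * \1_P (x - y) : R)%:E =
  ((\sum_(y <- l) L y * ((x - y)%R \in P))%N%:R : R)%:E.
Proof.
move=> bP l ul lP.
transitivity (\esum_(y in [set` l]) ((L y)%:R * \1_P (x - y) : R)%:E).
  rewrite esum_mkcond [RHS]esum_mkcond; apply: eq_esum => y _.
  have -> : (y \in mset_support L) = (0 < L y)%N.
    by apply/idP/idP => [/set_mem//|Ly]; exact: mem_set.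
  have -> : (y \in [set` l]) = (y \in l) by rewrite mem_setE.
  have [->|Ly] := posnP (L y); first by rewrite mul0r if_same.
  case: ifPn => // yl; rewrite indicE.
  have [/set_mem Pxy|] := boolP (x - y \in P); last by rewrite mulr0.
  by rewrite lP// -?lt0n in yl.
rewrite esum_fset; [|by apply/finite_seqP; exists l|by move=> y _;
    rewrite lee_fin mulr_ge0// indicE].
rewrite -fsbig_seq// sumEFin natr_sum; congr EFin; apply: eq_bigr => y _.
by rewrite indicE natrM.
Qed.

(** A lower bound available before any finiteness of L is known; [tiling_box_bound] derives the
    finiteness from it. *)
Lemma esum_mult_ge x l : uniq l -> (forall y, y \in l -> P (x - y)) ->
  (((\sum_(y <- l) L y)%N%:R : R)%:E <=
  \esum_(y in mset_support L) ((L y)%:R * \1_P (x - y) : R)%:E)%E.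
Proof.
move=> ul lP; pose l' := [seq y <- l | (0 < L y)%N].
apply: esum_ge; exists [set` l'].
  split; first by apply/finite_seqP; exists l'.
  by move=> y; rewrite /= mem_filter => /andP[].
rewrite -fsbig_seq ?filter_uniq// sumEFin lee_fin natr_sum /l' big_filter.
rewrite (bigID (fun y => 0 < L y)%N) /= [X in _ + X]big1 ?addr0; last first.
  by move=> y; rewrite -eqn0Ngt => /eqP ->.
rewrite big_seq_cond [leRHS]big_seq_cond ler_sum// => y /andP[yl _].
by rewrite indicE mem_set ?mulr1//; exact: lP.
Qed.

Variables (o : R * R) (r : R).
Hypotheses (bP : bdd P) (r_gt0 : 0 < r) (Po : forall u, box o r u -> P u).
Variable k : nat.
Hypothesis tiles : {ae ((@lebesgue_measure R) \x (@lebesgue_measure R))%E, forall x : R * R,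
      \esum_(l in mset_support L) ((L l)%:R * \1_P (x - l) : R)%:E = (k%:R : R)%:E}.

(** For x within r / 2 of a + o, each l within r / 2 of a has x - l within r of o, hence in P; so
    all these l count towards the multiplicity k at x. *)
Lemma tiling_box_bound : box_bound L (r / 2) k.
Proof.
apply: box_bound0; first exact: divr_gt0.
move=> a l ul al; have r2 : 0 < r / 2 by exact: divr_gt0.
have [x bx xk] := ae_dense (a + o) r2 tiles.
have := @esum_mult_ge x l ul; rewrite xk lee_fin ler_nat; apply => y /(allP al) /andP[h1 h2].
apply: Po; move: bx => /andP[]; rewrite !coordE => b1 b2; apply/andP; rewrite !coordE.
by move: h1 h2 b1 b2; rewrite !ler_norml; split; lra.
Qed.

Lemma tiling_dense a (h : R) : 0 < h ->
  exists2 x, box a h x & mass L [set l | P (x - l)] = k.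
Proof.
move=> h0; have [x bx xk] := ae_dense a h0 tiles; exists x => //.
have bA : bdd [set l | P (x - l)].
  have [rP rPP] := bP; exists (rP + (`|x.1| + `|x.2|)) => l /rPP/andP[].
  have := normr_ge0 x.1; have := normr_ge0 x.2; have := lexx `|x.1|; have := lexx `|x.2|.
  rewrite /box !coordE !ler_norml => a1 a2 a3 a4 a5 a6.
  by apply/andP; split; lra.
have r2 : 0 < r / 2 by exact: divr_gt0.
have [l [ul lP]] := cover_list r2 tiling_box_bound bA.
move: xk; rewrite (esum_mult bP ul lP) => -[/eqP]; rewrite eqr_nat => /eqP <-.
by rewrite (massE ul lP); apply: eq_bigr => y _; congr muln.
Qed.

End Tiling.

(** * Periods of a multiple tiling *)

Section Periodicity.
Context {R : realType}.
Implicit Types (u v w x y z a b c d f p q o : R * R) (P : set (R * R)).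

Lemma hull_bdd (s : seq (R * R)) : bdd (convex_hull [set` s]).
Proof.
have [rs sP] : exists rs : R, forall v, v \in s -> box 0 rs v.
  elim: s => [|v s [rs IH]]; first by exists 0.
  exists (Num.max rs (Num.max `|v.1| `|v.2|)) => u; rewrite inE => /predU1P[->|/IH/andP[h1 h2]].
    by rewrite /box !coordE !subr0 !le_max !lexx !orbT.
  by rewrite /box !le_max h1 h2.
exists rs => x; apply: (hull_sub (B := [set` box 0 rs])) => // y z t t01 /andP[h1 h2] /andP[h3 h4].
apply/andP; move: h1 h2 h3 h4; rewrite !coordE !subr0 => h1 h2 h3 h4.
have S (q g : R) : `|q| <= rs -> `|g| <= rs -> `|t * q + (1 - t) * g| <= rs.
  by rewrite !ler_norml => ? ?; nra.
by split; exact: S.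
Qed.

Lemma tiling_two_periods (s : seq (R * R)) (L : R * R -> nat) (o : R * R) (r r0 : R) (K0 k : nat) :
  let P := convex_hull [set` s] in
  ~ parallelogram P -> 0 < r -> (forall u, box o r u -> P u) ->
  0 < r0 -> box_bound L r0 K0 -> (exists x, L x != 0%N) ->
  (forall a (h : R), 0 < h -> exists2 x, box a h x & mass L [set l | P (x - l)] = k) ->
  exists a b, [/\ cross a b != 0, per (fun x => (L x)%:Z) a & per (fun x => (L x)%:Z) b].
Proof.
move=> P nP r_gt0 Po r0_gt0 Lb [x0 Lx0] dense.
have [v0 v0s] : exists v, v \in s.
  case: s @P nP Po dense => [P _ Po _|v s _ _ _ _]; last by exists v; rewrite inE eqxx.
  have : P o by apply: Po; rewrite box_center// ltW.
  by move/(hull_sub (B := set0)) => [].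
have [pv pvP] := choice (fun d => exists_lexmin d (- perp d) v0s).
have [qv qvP] := choice (fun d => exists_lexmin d (perp d) v0s).
have cP : cvx P by exact: hull_cvx.
have clP : closed P by exact: hull_closed.
have bP : bdd P by exact: hull_bdd.
have segs d (g g' : R) : d != 0 -> 0 <= g -> 0 <= g' -> ev pv qv d = g *: d ->
    ev pv qv (- d) = g' *: - d ->
    forall y, mass L (seg (y - pv d) d g) = mass L (seg (y - (pv (- d) - g' *: d)) d g').
  move=> d0 g0 g'0 gE g'E y; have dn : - d != 0 by rewrite oppr_eq0.
  apply: (edge_seg_eq cP clP bP r_gt0 Po d0 _ _ r0_gt0 Lb dense).
    exact: (pv_edge pvP qvP).
  by rewrite subrK; exact: (pv_edge pvP qvP).
(* Opposite sides of different lengths would force Lambda to vanish by [seg_eq_length]. Length 0 is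
   allowed there, so a side opposite to a mere vertex is excluded too. *)
have ev_opp d : d != 0 -> ev pv qv (- d) = - ev pv qv d.
  move=> d0; have dn : - d != 0 by rewrite oppr_eq0.
  have [g g0 gE] := evE pvP qvP d0; have [g' g'0 g'E] := evE pvP qvP dn.
  have H := segs d g g' d0 g0 g'0 gE g'E.
  have shift p p' y : y - p' = (y - p) - (p' - p) by vring.
  rewrite gE g'E scalerN; congr (- (_ *: _)).
  have [h|h|//] := ltgtP g' g.
    case/eqP: Lx0; apply: (seg_eq_length r0_gt0 Lb (d := d) (w :=
        pv (- d) - g' *: d - pv d) d0 g'0 h) => y.
    by rewrite -{1}[y](addrK (pv d)) H; congr mass; congr seg; vring.
  case/eqP: Lx0; apply: (seg_eq_length r0_gt0 Lb (d := d) (w :=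
      pv d - (pv (- d) - g' *: d)) d0 g0 h) => y.
  have := H (y + (pv (- d) - g' *: d)); rewrite addrK => <-; congr mass; congr seg; vring.
have m3 := three_edges pvP qvP r_gt0 Po ev_opp nP.
have eE := edge_diagonal pvP qvP r_gt0 Po ev_opp.
have tau_pos := tau_cross pvP qvP r_gt0 Po ev_opp.
apply: (two_periods r0_gt0 Lb m3 (diagonal_last pvP qvP r_gt0 Po ev_opp)).
- move=> i j ij; rewrite -!eE; first by rewrite gt_eqF// (edges_cross pvP qvP).
    by case/andP: ij.
  by case/andP: ij => /ltn_trans; apply.
- by move=> i j ij; rewrite gt_eqF// tau_pos.
- move=> i im y; rewrite -eE//.
  have [e0 E1 E2] := edge_pair pvP qvP r_gt0 Po ev_opp im.
  have H := edge_seg_eq cP clP bP r_gt0 Po e0 E1 E2 r0_gt0 Lb dense.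
  by rewrite -{1}[y](addrK (pv (nth 0 (edges s pv qv) i))) H; congr mass; congr seg; vring.
Qed.

End Periodicity.

Theorem theorem1p9 (R : realType) (P : set (R * R)) (Lambda : R * R -> nat)
    (P_polygon : convex_polygon P) (P_not_parallelogram : ~ parallelogram P)
    (Lambda_discrete : discrete_multiset Lambda)
    (Lambda_tiles : multi_tiles P Lambda) :
  exists L : set (R * R),
    [/\ lattice L, translation_invariant Lambda L &
        finite_union_of_translates Lambda L].
Proof.
have [[s PE] [c /nbhs_boxP[r r0 Po]]] := P_polygon; subst P.
have [k [k0 tiles]] := Lambda_tiles.
have bP : bdd (convex_hull [set` s]) by exact: hull_bdd.
have r2 : 0 < r / 2 by exact: divr_gt0.
have Lb := tiling_box_bound r0 Po tiles.
have dense := tiling_dense bP r0 Po tiles.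
(* An empty Lambda would give multiplicity 0, whereas k is positive. *)
have L0 : exists x, Lambda x != 0%N.
  apply: contrapT => /forallNP H; have [x _ xk] := dense 0 1 ltr01.
  move: k0; rewrite -xk /mass fsbig1// => y _; have /negP/negPn/eqP := H y.
  by [].
have [a [b [ab [M M0 aP] [N N0 bN]]]] :=
  tiling_two_periods P_not_parallelogram r0 Po r2 Lb L0 dense.
have ab' : cross (M%:R *: a) (N%:R *: b) != 0.
  rewrite (_ : cross _ _ = M%:R * N%:R * cross a b); last by rewrite /cross !coordE; ring.
  by rewrite !mulf_neq0// pnatr_eq0 -lt0n.
exists (range (lattice_map (M%:R *: a) (N%:R *: b))).
have nat_eq (m n : nat) : m%:Z = n%:Z -> m = n by case.
have [h1 h2] := lattice_mult r2 Lb ab' (fun x => nat_eq _ _ (aP x)) (fun x => nat_eq _ _ (bN x)).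
split => //; exact: lattice_range.
Qed.
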